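(* The following decision problem is in $\Sigma_5^{P}$ (the fifth existential level of the polynomial hierarchy): given two finite iCGS $\mathcal G$ and $\mathcal G'$ on the same set $Ag$ of agents and the same set $AP$ of atoms, a coalition $A\subseteq Ag$, a state $q$ of $\mathcal G$ and a state $q'$ of $\mathcal G'$, decide whether the pointed iCGS $(\mathcal G,q)$ and $(\mathcal G',q')$ are $A$-bisimilar, i.e. whether there exists an $A$-bisimulation $R$ between $\mathcal G$ and $\mathcal G'$ with $q\,R\,q'$.
   Context: **iCGS.** A concurrent game structure with imperfect information (iCGS) is a tuple $\mathcal G=\langle Ag,AP,S,s_0,Act,\{\sim_i\}_{i\in Ag},d,\to,\pi\rangle$ where: $Ag$ is a nonempty finite set of agents (subsets $A\subseteq Ag$ are called coalitions); $AP$ is a set of atoms; $S$ is a nonempty set of states and $s_0\in S$; $Act$ is a finite nonempty set of actions, and a joint action is a tuple $\vec a=(a_i)_{i\in Ag}\in Act^{Ag}$; each $\sim_i$ is an equivalence relation on $S$; $d:Ag\times S\to 2^{Act}\setminus\{\emptyset\}$ satisfies $d(i,s)=d(i,s')$ whenever $s\sim_i s'$; $\to\subseteq S\times Act^{Ag}\times S$ is such that for all $s\in S$ and $\vec a\in Act^{Ag}$, there is $s'$ with $(s,\vec a,s')\in\to$ (written $s\xrightarrow{\vec a}s'$) iff $a_i\in d(i,s)$ for every $i\in Ag$; and $\pi:S\to 2^{AP}$. Components of $\mathcal G'$ are written with primes. A pointed iCGS is a pair $(\mathcal G,s)$ with $s$ a state of $\mathcal G$. For the decision problem, the iCGS are finite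 and given explicitly; the input size is measured by the number of states, transitions and epistemic links (pairs in the relations $\sim_i$). **Knowledge.** $\sim^E_A=\bigcup_{i\in A}\sim_i$, and $\sim^C_A$ is the transitive closure of $\sim^E_A$, regarded as an equivalence relation on $S$; $C_A(q)=\{q'\in S\mid q'\sim^C_A q\}$ is the common knowledge neighbourhood of $q$ ($C'_A$ denotes the one in $\mathcal G'$). **Partial strategies.** A partial (uniform) strategy for agent $i$ is a partial function $\sigma:S\to Act$ such that, on its domain $dom(\sigma)$, $\sigma(s)\in d(i,s)$, and $\sigma(s)=\sigma(s')$ whenever $s\sim_i s'$. For $Q\subseteq S$, $PStr_A(Q)$ is the set of tuples $(\sigma_i)_{i\in A}$ of partial strategies, $\sigma_i$ for agent $i$, with $dom(\sigma_i)=Q$ for all $i\in A$. For $\sigma_A=(\sigma_i)_{i\in A}$, $succ(s,\sigma_A)$ is the set of states $r$ such that $s\xrightarrow{\vec a}r$ for some joint action $\vec a$ with $a_i=\sigma_i(s)$ for all $i\in A$. **Bisimulation.** A simulator of partial strategies for $A$ with respect to $R\subseteq S\times S'$ is a family $ST$ of functions $ST_{C_A(q),C'_A(q')}:PStr_A(C_A(q))\to PStr_A(C'_A(q'))$, one for each pair of neighbourhoods $C_A(q),C'_A(q')$ with $q\,R\,q'$ (the function depends only on the pair of neighbourhoods). $R$ is a simulation for $A$ (from $\mathcal G$ to $\mathcal G'$) iff: (1) there exists a simulator $ST$ of partial strategies for $A$ w.r.t. $R$ such that $q\,R\,q'$ implies: (a) $\pi(q)=\pi'(q')$; (b) for every $i\in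 A$ and $r'\in S'$, if $q'\sim'_i r'$ then for some $r\in S$, $q\sim_i r$ and $r\,R\,r'$; (c) for all $r\in C_A(q)$, $r'\in C'_A(q')$ with $r\,R\,r'$, every $\sigma_A\in PStr_A(C_A(q))$ and every $s'\in succ(r',ST_{C_A(q),C'_A(q')}(\sigma_A))$, there is $s\in succ(r,\sigma_A)$ with $s\,R\,s'$; (2) if $q_1\,R\,q'$ and $q_2\,R\,q'$ then $C_A(q_1)=C_A(q_2)$. $R$ is an $A$-bisimulation iff both $R$ and its converse $R^{-1}$ (from $\mathcal G'$ to $\mathcal G$) are simulations for $A$. *)

(* Defs.v *)
From HB Require Import structures.
From mathcomp Require Import all_boot all_order all_algebra.

Set Implicit Arguments.
Unset Strict Implicit.
Unset Printing Implicit Defensive.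

(** * Deterministic multi-tape Turing machines *)

Inductive move := MoveL | MoveN | MoveR.

Section Machine.
Variable n : nat.

(* A machine reading [n] input strings, one per read-write input tape
   [inl i]; the tapes [inr t] are work tapes.  A cell is blank ([None]),
   a bit, or one of the machine's own work symbols.  [tm_verdict s] is
   [Some b] exactly when [s] is a halting state with answer [b]. *)
Record TM := {
  tm_state : finType;
  tm_work : finType;
  tm_symbol : finType;
  tm_start : tm_state;
  tm_verdict : tm_state -> option bool;
  tm_trans : tm_state ->
    {ffun 'I_n + tm_work -> option (bool + tm_symbol)} ->
    tm_state * ('I_n + tm_work -> option (bool + tm_symbol) * move)
}.

Variable M : TM.

Definition cell : Type := option (bool + tm_symbol M).
Definition tape_index : Type := ('I_n + tm_work M)%type.

(* Two-way infinite tape [(l, r)]: [l] holds the cells left of the head,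
   nearest first, [r] the scanned cell and those to its right; all cells
   not listed are blank. *)
Definition tape : Type := (seq cell * seq cell)%type.

Definition tape_read (t : tape) : cell := head None t.2.

Definition tape_act (t : tape) (cm : cell * move) : tape :=
  let r := cm.1 :: behead t.2 in
  match cm.2 with
  | MoveL => (behead t.1, head None t.1 :: r)
  | MoveN => (t.1, r)
  | MoveR => (cm.1 :: t.1, behead t.2)
  end.

Definition config : Type := (tm_state M * {ffun tape_index -> tape})%type.

Definition tm_step (c : config) : config :=
  if tm_verdict c.1 is Some _ then c else
  let sa := tm_trans c.1 [ffun i => tape_read (c.2 i)] in
  (sa.1, [ffun i => tape_act (c.2 i) (sa.2 i)]).

Definition tm_init (xs : seq (seq bool)) : config :=
  (tm_start M,
   [ffun i : tape_index =>
      match i with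
      | inl j => ([::], [seq Some (inl b) | b <- nth [::] xs j])
      | inr _ => ([::], [::])
      end]).

Definition tm_result (t : nat) (xs : seq (seq bool)) : option bool :=
  tm_verdict (iter t tm_step (tm_init xs)).1.

End Machine.

(** * The polynomial hierarchy *)

(* [V] is a polynomial-time predicate of [n] strings (polynomial in their
   total length). *)
Definition polytime (n : nat) (V : seq (seq bool) -> bool) : Prop :=
  exists (M : TM n) (p : {poly nat}),
    forall xs, size xs = n ->
      tm_result M (p.[sumn [seq size x | x <- xs]])%R xs = Some (V xs).

(* [k] alternating quantifiers over strings of length at most [b], starting
   with an existential one iff [e]; the values are appended to [xs]. *)
Fixpoint alternate (e : bool) (k b : nat) (V : seq (seq bool) -> bool)
    (xs : seq (seq bool)) : Prop :=
  match k with
  | 0 => V xs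
  | k'.+1 =>
    if e then exists u, size u <= b /\ alternate (~~ e) k' b V (rcons xs u)
    else forall u, size u <= b -> alternate (~~ e) k' b V (rcons xs u)
  end.

Definition SigmaP (k : nat) (L : seq bool -> Prop) : Prop :=
  exists (V : seq (seq bool) -> bool) (p : {poly nat}),
    polytime k.+1 V /\
    forall x, L x <-> alternate true k (p.[size x])%R V [:: x].

(** * Finite concurrent game structures with imperfect information *)

Record iCGS (Ag AP : finType) := {
  St : finType;
  Act : finType;
  init : St;
  ind : Ag -> rel St;
  avail : Ag -> St -> {set Act};
  trans : St -> {ffun Ag -> Act} -> St -> bool;
  label : St -> {set AP};
  Ag_gt0 : 0 < #|Ag|;
  Act_gt0 : 0 < #|Act|;
  ind_equiv : forall i, equivalence_rel (ind i);
  avail_neq0 : forall i s, avail i s != set0;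
  avail_ind : forall i s s', ind i s s' -> avail i s = avail i s';
  transP : forall s a, (exists s', trans s a s') <-> forall i, a i \in avail i s
}.

Section Strategies.
Variables (Ag AP : finType) (G : iCGS Ag AP) (A : {set Ag}).

Definition everybody : rel (St G) :=
  [rel s s' | [exists i in A, ind i s s']].

(* [connect] is the reflexive-transitive closure; reflexivity only matters
   for the empty coalition, whose neighbourhoods are singletons. *)
Definition neighbourhood (q : St G) : {set St G} :=
  [set q' | connect everybody q' q].

Definition pstrategy : Type := {ffun St G -> option (Act G)}.

Definition dom (f : pstrategy) : {set St G} := [set s | isSome (f s)].

Definition uniform_for (i : Ag) (f : pstrategy) : Prop :=
  (forall s a, f s = Some a -> a \in avail i s) /\
  (forall s s', s \in dom f -> s' \in dom f -> ind i s s' -> f s = f s').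

Definition coalition_pstrategy : Type := {ffun {i : Ag | i \in A} -> pstrategy}.

Definition PStr (Q : {set St G}) (f : coalition_pstrategy) : Prop :=
  forall i, uniform_for (val i) (f i) /\ dom (f i) = Q.

Definition succ (s : St G) (f : coalition_pstrategy) : {set St G} :=
  [set r | [exists a : {ffun Ag -> Act G},
     trans s a r && [forall i, f i s == Some (a (val i))]]].

End Strategies.

Section Bisimulation.
Variables (Ag AP : finType).

Definition simulator (G G' : iCGS Ag AP) (A : {set Ag})
    (R : St G -> St G' -> bool)
    (ST : {set St G} -> {set St G'} ->
          coalition_pstrategy G A -> coalition_pstrategy G' A) : Prop :=
  forall q q', R q q' ->
    forall f, PStr (neighbourhood A q) f ->
      PStr (neighbourhood A q')
        (ST (neighbourhood A q) (neighbourhood A q') f).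

Definition simulation (G G' : iCGS Ag AP) (A : {set Ag})
    (R : St G -> St G' -> bool) : Prop :=
  (exists ST : {set St G} -> {set St G'} ->
               coalition_pstrategy G A -> coalition_pstrategy G' A,
    simulator R ST /\
    forall q q', R q q' ->
      [/\ label q = label q',
          forall i r', i \in A -> ind i q' r' ->
            exists r, ind i q r /\ R r r'
        & forall r r', r \in neighbourhood A q -> r' \in neighbourhood A q' ->
            R r r' ->
            forall f, PStr (neighbourhood A q) f ->
            forall s',
              s' \in succ r' (ST (neighbourhood A q) (neighbourhood A q') f) ->
            exists s, s \in succ r f /\ R s s'])
  /\ (forall q1 q2 q', R q1 q' -> R q2 q' ->
        neighbourhood A q1 = neighbourhood A q2).

Definition bisimulation (G G' : iCGS Ag AP) (A : {set Ag})
    (R : St G -> St G' -> bool) : Prop :=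
  simulation A R /\ simulation A (fun q' q => R q q').

Definition bisimilar (G G' : iCGS Ag AP) (A : {set Ag})
    (q : St G) (q' : St G') : Prop :=
  exists R : St G -> St G' -> bool, bisimulation A R /\ R q q'.

End Bisimulation.

(** * The decision problem as a language *)

(* A self-delimiting binary code: each item of a list is announced by a
   [true], and elements of finite types are numbered in unary.  Agents, atoms,
   states and actions being given explicitly, the length of a code without
   repetitions is polynomial in their numbers and in the numbers of
   transitions and epistemic links. *)
Definition code_nat (n : nat) : seq bool := nseq n true ++ [:: false].

Definition code_seq (T : Type) (code : T -> seq bool) (s : seq T) : seq bool :=
  flatten [seq true :: code x | x <- s] ++ [:: false].

Definition code_elt (T : finType) (x : T) : seq bool := code_nat (enum_rank x).

Definition code_profile (Ag T : finType) (a : {ffun Ag -> T}) : seq bool :=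
  flatten [seq code_elt (a i) | i <- enum Ag].

(* Relations are given as the lists of their tuples, in any order,
   possibly with repetitions: [links]
   for the indistinguishability relations, [acts] for the available actions,
   [edges] for the transitions and [labels] for the valuation. *)
Definition encodes_iCGS (Ag AP : finType) (G : iCGS Ag AP) (w : seq bool) :
    Prop :=
  exists (links : seq (Ag * St G * St G)) (acts : seq (Ag * St G * Act G))
         (edges : seq (St G * {ffun Ag -> Act G} * St G))
         (labels : seq (St G * AP)),
  [/\ forall i s s', ((i, s, s') \in links) = ind i s s',
      forall i s a, ((i, s, a) \in acts) = (a \in avail i s),
      forall s a s', ((s, a, s') \in edges) = trans s a s',
      forall s p, ((s, p) \in labels) = (p \in label s)
    & w = code_nat #|St G| ++ code_nat #|Act G| ++ code_elt (init G) ++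
          code_seq (fun t => code_elt t.1.1 ++ code_elt t.1.2 ++ code_elt t.2)
            links ++
          code_seq (fun t => code_elt t.1.1 ++ code_elt t.1.2 ++ code_elt t.2)
            acts ++
          code_seq
            (fun t => code_elt t.1.1 ++ code_profile t.1.2 ++ code_elt t.2)
            edges ++
          code_seq (fun t => code_elt t.1 ++ code_elt t.2) labels].

Definition encodes_instance (Ag AP : finType) (G G' : iCGS Ag AP)
    (A : {set Ag}) (q : St G) (q' : St G') (w : seq bool) : Prop :=
  exists (wG wG' : seq bool) (members : seq Ag),
  [/\ encodes_iCGS G wG, encodes_iCGS G' wG', members =i A
    & w = code_nat #|Ag| ++ code_nat #|AP| ++ wG ++ wG' ++
          code_seq (@code_elt Ag) members ++ code_elt q ++ code_elt q'].

Definition bisimilarity_problem (w : seq bool) : Prop :=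
  exists (Ag AP : finType) (G G' : iCGS Ag AP) (A : {set Ag})
         (q : St G) (q' : St G'),
    encodes_instance A q q' w /\ bisimilar A q q'.

(* Main.v *)
Require Import Defs.
From HB Require Import structures.
From mathcomp Require Import all_boot all_order all_algebra.
From mathcomp Require Import zify.
From Stdlib Require Import Classical_Prop FunctionalExtensionality.

(** Once [R] is fixed, a simulator of strategies exists iff every strategy on a
    neighbourhood has a suitable response on the related neighbourhood.  Hence
    bisimilarity reads "there is [R] such that for every strategy there is a
    response such that", followed by a first-order condition on the explicitly
    given structures.  The string [u1] lists [R], its converse and the two
    common knowledge relations.  The universal string [u2] is read in three
    ways at once: as a joint action (an available one must have a successor),
    as a set closed under the links of the coalition (so the neighbourhoods
    listed in [u1] are not too large), and as two states followed by a strategy.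
    The strings [u3] and [u5] are the responses in the two directions; [u4] is
    idle.

    Evaluating the first-order condition only moves pointers inside the given
    strings.  This can be done by loop programs over stacks of bits that never
    outgrow the longest input, hence in polynomial time, and the part of a tape
    to the right of its head is such a stack. *)

Set Implicit Arguments.
Unset Strict Implicit.
Unset Printing Implicit Defensive.

(** * Stack programs and their Turing machines *)

(** The universal string carries the objects that are exponentially many: strategies, closed sets,
    and joint actions, whose number is exponential in the number of agents. Because of the joint
    actions, even being the code of a structure is a universal condition and cannot be left to a
    preliminary polynomial-time test. The common knowledge relations are guessed rather than
    computed, so that the polynomial-time part has only quantifiers over listed objects and no
    fixpoint. A simulator is a function of a pair of neighbourhoods, whereas a challenge names a
    pair of states. No coherence is lost, because a response is tested on all related pairs within
    the two neighbourhoods: whether it is suitable depends on the neighbourhoods and the strategy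
    only. The converse of [R] is listed so that both directions are one formula with the structures
    exchanged. *)

Definition store := nat -> seq bool.

Definition upd (st : store) r v : store := fun i => if i == r then v else st i.

Inductive cmd :=
| Push of nat & bool
| Pop of nat
| Seq of cmd & cmd
| If of nat & (option bool -> bool) & cmd & cmd
| While of nat & (option bool -> bool) & cmd.

(** The number counts steps of the compiled machine. A push costs two, because the head first moves
    left and only then can write; each test costs one. *)
Inductive exec : cmd -> store -> nat -> store -> Prop :=
| ExecPush st r b : exec (Push r b) st 2 (upd st r (b :: st r))
| ExecPop st r : exec (Pop r) st 1 (upd st r (behead (st r)))
| ExecSeq c d st t st1 t' st2 :
    exec c st t st1 -> exec d st1 t' st2 -> exec (Seq c d) st (t + t') st2
| ExecIfT st (r : nat) (p : option bool -> bool) c d t st' :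
    p (ohead (st r)) -> exec c st t st' -> exec (If r p c d) st t.+1 st'
| ExecIfF st (r : nat) (p : option bool -> bool) c d t st' :
    ~~ p (ohead (st r)) -> exec d st t st' -> exec (If r p c d) st t.+1 st'
| ExecWhileF st (r : nat) (p : option bool -> bool) c :
    ~~ p (ohead (st r)) -> exec (While r p c) st 1 st
| ExecWhileT st (r : nat) (p : option bool -> bool) c t st1 t' st2 :
    p (ohead (st r)) -> exec c st t st1 -> exec (While r p c) st1 t' st2 ->
    exec (While r p c) st (t + t').+1 st2.

Fixpoint regs_below K (c : cmd) : bool :=
  match c with
  | Push r _ | Pop r => r < K
  | Seq c d => regs_below K c && regs_below K d
  | If r _ c d => [&& r < K, regs_below K c & regs_below K d]
  | While r _ c => (r < K) && regs_below K c
  end.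

Lemma regs_belowW K K' c : K <= K' -> regs_below K c -> regs_below K' c.
Proof.
move=> le_K; elim: c => [r b|r|c IHc d IHd|r p c IHc d IHd|r p c IHc] /=.
- by move/leq_trans; apply.
- by move/leq_trans; apply.
- by move=> /andP[/IHc-> /IHd->].
- by move=> /and3P[/leq_trans-> // /IHc-> /IHd->].
- by move=> /andP[/leq_trans-> // /IHc->].
Qed.

Lemma regs_below_ex c : exists K, regs_below K c.
Proof.
elim: c => [r b|r|c [K HK] d [K' HK']|r p c [K HK] d [K' HK']|r p c [K HK]] /=.
- by exists r.+1.
- by exists r.+1.
- by exists (maxn K K'); rewrite (regs_belowW (leq_maxl _ _) HK)
    (regs_belowW (leq_maxr _ _) HK').
- exists (maxn r.+1 (maxn K K')); rewrite leq_maxl /=; apply/andP; split.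
    by apply: regs_belowW HK; rewrite !leq_max leqnn orbT.
  by apply: regs_belowW HK'; rewrite !leq_max leqnn !orbT.
- by exists (maxn r.+1 K); rewrite leq_maxl (regs_belowW (leq_maxr _ _) HK).
Qed.

(** * Compilation of stack programs into multi-tape machines *)

Section Compile.

(** Control points of a program. In a conditional or a loop the additional [None] is the point where
    the test is made; in [Push] the two values separate the move from the write. *)
Fixpoint pos (c : cmd) : finType :=
  match c with
  | Push _ _ => bool
  | Pop _ => unit
  | Seq c d => (pos c + pos d)%type
  | If _ _ c d => option (pos c + pos d)
  | While _ _ c => option (pos c)
  end.

Fixpoint entry (c : cmd) : pos c :=
  match c with
  | Push _ _ => false
  | Pop _ => tt
  | Seq c d => inl (entry c)
  | If _ _ c d => None
  | While _ _ c => None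
  end.

Definition action := nat -> option bool * move.
Definition reading := nat -> option bool.

Definition idle (rd : reading) : action := fun r => (rd r, MoveN).

(** A resulting position [None] means that control leaves the program. A sequence turns the exit of
    its first part into the entry of its second; in a loop the exit of the body is, as it stands,
    the point of the test. *)
Fixpoint step (c : cmd) : pos c -> reading -> option (pos c) * action :=
  match c return pos c -> reading -> option (pos c) * action with
  | Push r b => fun s rd =>
      if s then (None, fun i => if i == r then (Some b, MoveN) else idle rd i)
      else (Some true, fun i => if i == r then (rd i, MoveL) else idle rd i)
  | Pop r => fun s rd =>
      (None, fun i => if i == r then (None, MoveR) else idle rd i)
  | Seq c d => fun s rd =>
      match s with
      | inl s => let: (s', a) := step s rd in
          (Some (if s' is Some s' then inl s' else inr (entry d)), a)
      | inr s => let: (s', a) := step s rd in (omap inr s', a)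
      end
  | If r p c d => fun s rd =>
      match s with
      | None =>
          (Some (Some (if p (rd r) then inl (entry c) else inr (entry d))),
           idle rd)
      | Some (inl s) =>
          let: (s', a) := step s rd in (omap (Some \o inl) s', a)
      | Some (inr s) =>
          let: (s', a) := step s rd in (omap (Some \o inr) s', a)
      end
  | While r p c => fun s rd =>
      match s with
      | None => (if p (rd r) then Some (Some (entry c)) else None, idle rd)
      | Some s => let: (s', a) := step s rd in (Some s', a)
      end
  end.

Variables (n m : nat).

Definition track (r : nat) : 'I_n + 'I_m.+1 :=
  if insub r is Some i then inl i else inr (inord (r - n)).

Definition register (i : 'I_n + 'I_m.+1) : nat :=
  match i with inl i => i | inr j => n + j end.

Lemma trackK r : r < n + m.+1 -> register (track r) = r.
Proof.
rewrite /track => lt_r; case: insubP => [i _ <- //|]; rewrite -leqNgt => le_nr /=.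
by rewrite inordK; lia.
Qed.

Definition cell_bit (c : option (bool + void)) : option bool :=
  if c is Some (inl b) then Some b else None.

Definition bit_cell (b : option bool) : option (bool + void) := omap inl b.

(** A finished program takes one more step, which turns the top of register [n], the first work
    tape, into the verdict. *)
Definition machine (c : cmd) : TM n := {|
  tm_state := (option (pos c) + bool)%type;
  tm_work := 'I_m.+1;
  tm_symbol := void;
  tm_start := inl (Some (entry c));
  tm_verdict := fun s => if s is inr b then Some b else None;
  tm_trans := fun s f =>
    let rd := fun r => cell_bit (f (track r)) in
    match s with
    | inl (Some p) =>
        let s'a := step p rd in
        (inl s'a.1,
         fun i => (bit_cell (s'a.2 (register i)).1, (s'a.2 (register i)).2))
    | inl None => (inr (rd n == Some true), fun i => (f i, MoveN))
    | inr b => (inr b, fun i => (f i, MoveN))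
    end
|}.

(* The cells to the left of the head are garbage: pushing moves the head left
   and overwrites the cell found there. *)
Definition holds (t : seq (option (bool + void)) * seq (option (bool + void)))
    (s : seq bool) :=
  exists k, t.2 = map (Some \o inl) s ++ nseq k None.

Lemma holds_read t s : holds t s -> cell_bit (head None t.2) = ohead s.
Proof. by case=> k ->; case: s => [|b s] //=; case: k. Qed.

Lemma cell_bitK : cancel cell_bit bit_cell.
Proof. by case=> [[]|]. Qed.

Variable c0 : cmd.
Notation M := (machine c0).

Lemma holds_idle (t : tape M) s :
  holds t s -> holds (tape_act t (bit_cell (cell_bit (tape_read t)), MoveN)) s.
Proof.
rewrite cell_bitK => -[k]; case: t => l r /= ->; case: s => [|b s] /=; last by exists k.
by exists k.-1.+1; case: k.
Qed.

(** The invariant on the tapes is a parameter, since halfway through a push the scanned cell is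
    garbage and the register starts one cell further right. *)
Definition situated (cfg : config M) (s : tm_state M) (inv : nat -> tape M -> Prop) :=
  cfg.1 = s /\ forall r, r < n + m.+1 -> inv r (cfg.2 (track r)).

Definition simulates cfg s (st : store) := situated cfg s (fun r t => holds t (st r)).

(** The map [f] places the control points of a subprogram among the states of the whole machine, and
    [f None] is the state reached on leaving it. Quantifying over such continuations makes the
    induction on executions go through. *)
Definition embeds c (f : option (pos c) -> tm_state M) :=
  forall p (rd : {ffun tape_index M -> cell M}),
    let s'a := step p (fun r => cell_bit (rd (track r))) in
    tm_verdict (f (Some p)) = None /\
    tm_trans (f (Some p)) rd =
      (f s'a.1, fun i => (bit_cell (s'a.2 (register i)).1, (s'a.2 (register i)).2)).

Lemma simulate_step c f (p : pos c) cfg inv inv' :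
  embeds f -> situated cfg (f (Some p)) inv ->
  let s'a := step p (fun r => cell_bit ([ffun i => tape_read (cfg.2 i)] (track r))) in
  (forall r (t : tape M), r < n + m.+1 -> t = cfg.2 (track r) -> inv r t ->
     inv' r (tape_act t (bit_cell (s'a.2 r).1, (s'a.2 r).2))) ->
  situated (tm_step cfg) (f s'a.1) inv'.
Proof.
move=> emb [Es Htp] s'a Hst.
have [v tr] := emb p [ffun i => tape_read (cfg.2 i)].
rewrite /tm_step Es v tr; split=> //= r lt_r.
by rewrite ffunE trackK //; apply: Hst => //; apply: Htp.
Qed.

Lemma simulate c : regs_below (n + m.+1) c -> forall st t st', exec c st t st' ->
  forall f cfg, embeds f -> simulates cfg (f (Some (entry c))) st ->
  simulates (iter t (@tm_step _ M) cfg) (f None) st'.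
Proof.
move=> below st t st' ex; elim: ex below => {c st t st'}.
- move=> st r b /= lt_r f cfg emb sim.
  have sim1 : situated (tm_step cfg) (f (Some true)) (fun i t =>
      if i == r then holds (t.1, behead t.2) (st i) else holds t (st i)).
    have := simulate_step emb sim; apply=> i t lt_i -> /=.
    case: eqP => [->|_] Ht /=; last by rewrite /idle ffunE; apply: holds_idle.
    by rewrite ffunE; move: Ht; case: (cfg.2 _) => l q /=; apply: holds_idle.
  have := simulate_step emb sim1; apply=> i t lt_i -> /=; rewrite /upd.
  case: eqP => [->|_] Ht; last by rewrite /idle ffunE; apply: holds_idle.
  by move: Ht; case: (_ (track r)) => l q [k /= E]; exists k; rewrite /= E.
- move=> st r /= lt_r f cfg emb sim.
  have := simulate_step emb sim; apply=> i t lt_i -> /=; rewrite /upd.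
  case: eqP => [->|_] /=.
    case: (cfg.2 _) => l q [k /= ->].
    by case: (st r) => [|b s] /=; [exists k.-1; case: k|exists k].
  rewrite /idle /= ffunE; exact: holds_idle.
- move=> c d st t st1 t' st2 _ IHc _ IHd /= /andP[/IHc{}IHc /IHd{}IHd] f cfg emb sim.
  rewrite addnC iterD; apply: (IHd (fun p => f (omap inr p))).
    by move=> p rd; have := emb (inr p) rd; rewrite /=; case: (step p _).
  rewrite -/(omap inr (Some (entry d))).
  apply: (IHc (fun p => f (Some (if p is Some p then inl p else inr (entry d))))) => //.
  by move=> p rd; have := emb (inl p) rd; rewrite /=; case: (step p _).
- move=> st r p c d t st' Hp _ IHc /= /and3P[lt_r /IHc{}IHc _] f cfg emb sim.
  rewrite -iterS iterSr; apply: (IHc (fun p => f (omap (Some \o inl) p))).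
    by move=> q rd; have := emb (Some (inl q)) rd; rewrite /=; case: (step q _).
  have [_ Htp] := sim; have := simulate_step emb sim; rewrite /= ffunE.
  rewrite /tape_read (holds_read (Htp r lt_r)) Hp; apply=> i t0 lt_i -> Ht.
  rewrite /idle ffunE; exact: holds_idle.
- move=> st r p c d t st' Hp _ IHd /= /and3P[lt_r _ /IHd{}IHd] f cfg emb sim.
  rewrite -iterS iterSr; apply: (IHd (fun p => f (omap (Some \o inr) p))).
    by move=> q rd; have := emb (Some (inr q)) rd; rewrite /=; case: (step q _).
  have [_ Htp] := sim; have := simulate_step emb sim; rewrite /= ffunE.
  rewrite /tape_read (holds_read (Htp r lt_r)) (negPf Hp); apply=> i t0 lt_i -> Ht.
  rewrite /idle ffunE; exact: holds_idle.
- move=> st r p c Hp /= /andP[lt_r _] f cfg emb sim.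
  have [_ Htp] := sim; have := simulate_step emb sim; rewrite /= ffunE.
  rewrite /tape_read (holds_read (Htp r lt_r)) (negPf Hp); apply=> i t0 lt_i -> Ht.
  rewrite /idle ffunE; exact: holds_idle.
move=> st r p c t st1 t' st2 Hp _ IHc _ IHw /= below f cfg emb sim.
have /andP[lt_r /IHc{}IHc] := below.
rewrite -iterS iterSr addnC iterD; apply: IHw => //.
apply: (IHc (fun q => f (Some q))).
  by move=> q rd; have := emb (Some q) rd; rewrite /=; case: (step q _).
have [_ Htp] := sim; have := simulate_step emb sim; rewrite /= ffunE.
rewrite /tape_read (holds_read (Htp r lt_r)) Hp; apply=> i t0 lt_i -> Ht.
rewrite /idle ffunE; exact: holds_idle.
Qed.

(** Halting configurations are fixed by [tm_step], so every time beyond [t] gives the same answer;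
    strictness pays for the step that issues the verdict. *)
Lemma machine_result t st st' xs T :
  regs_below (n + m.+1) c0 -> exec c0 st t st' ->
  st =1 nth [::] xs -> size xs = n -> t < T ->
  tm_result M T xs = Some (ohead (st' n) == Some true).
Proof.
move=> below ex st_xs size_xs lt_tT.
have emb : embeds (fun p : option (pos c0) => inl p : tm_state M) by [].
have sim0 : simulates (tm_init M xs) (inl (Some (entry c0))) st.
  split=> // r lt_r; rewrite ffunE st_xs /track; case: insubP => [i _ <- /=|].
    by exists 0; rewrite cats0.
  by rewrite -leqNgt => le_nr; exists 0; rewrite nth_default ?size_xs.
have [Es Htp] := simulate below ex emb sim0.
rewrite /tm_result -(subnK lt_tT) iterD iterS.
set cfg := iter t _ _ in Es Htp *.
have -> : tm_step cfg =
    (inr (ohead (st' n) == Some true), [ffun i => tape_act (cfg.2 i) (tape_read (cfg.2 i), MoveN)]).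
  rewrite /tm_step Es /= ffunE; congr (inr (_ == _), _).
    by apply: holds_read; apply: Htp; rewrite addnS ltnS leq_addr.
  by apply/ffunP => i; rewrite !ffunE.
by elim: (T - t.+1) => [//|j IH]; rewrite iterSr /tm_step /=.
Qed.

End Compile.

(** * Polynomial-time functions on pointers *)

Definition bounded B (st : store) := forall r, size (st r) <= B.+1.

Definition reaches B T c st (Q : store -> Prop) :=
  exists t st', [/\ exec c st t st', t <= T, bounded B st' & Q st'].

Lemma reachesW B T T' c st (Q Q' : store -> Prop) :
  T <= T' -> (forall st', bounded B st' -> Q st' -> Q' st') ->
  reaches B T c st Q -> reaches B T' c st Q'.
Proof.
move=> le_T QQ' [t [st' [ex le_t bst' Qst']]]; exists t, st'; split=> //.
  exact: leq_trans le_T.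
exact: QQ'.
Qed.

Lemma reaches_seq B T T' c d st Q Q' :
  reaches B T c st Q ->
  (forall st1, bounded B st1 -> Q st1 -> reaches B T' d st1 Q') ->
  reaches B (T + T') (Seq c d) st Q'.
Proof.
move=> [t [st1 [ex le_t b1 Q1]]] /(_ _ b1 Q1)[t' [st2 [ex' le_t' b2 Q2]]].
exists (t + t'), st2; split=> //; [exact: ExecSeq ex ex'|exact: leq_add].
Qed.

Lemma reaches_if B T (r : nat) (p : option bool -> bool) c d st Q :
  (p (ohead (st r)) -> reaches B T c st Q) ->
  (~~ p (ohead (st r)) -> reaches B T d st Q) ->
  reaches B T.+1 (If r p c d) st Q.
Proof.
case: (boolP (p (ohead (st r)))) => Hp.
  move=> /(_ isT)[t [st' [ex le_t b' Q']]] _; exists t.+1, st'; split=> //.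
  exact: ExecIfT.
move=> _ /(_ isT)[t [st' [ex le_t b' Q']]]; exists t.+1, st'; split=> //.
exact: ExecIfF.
Qed.

(** The index of the invariant counts the iterations still to be made, so it yields both termination
    and the time bound. *)
Lemma reaches_while B T (r : nat) (p : option bool -> bool) c (I : nat -> store -> Prop) m st :
  bounded B st -> I m st ->
  (forall j st1, bounded B st1 -> I j st1 -> p (ohead (st1 r)) = (0 < j)) ->
  (forall j st1, bounded B st1 -> I j.+1 st1 -> reaches B T c st1 (I j)) ->
  reaches B (m * T.+1).+1 (While r p c) st (I 0).
Proof.
move=> bst Ist Hp Hc; elim: m st bst Ist => [|m IH] st bst Ist.
  by exists 1, st; split=> //; apply: ExecWhileF; rewrite (Hp 0).
have [t [st1 [ex le_t b1 I1]]] := Hc _ _ bst Ist.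
have [t' [st2 [ex' le_t' b2 I2]]] := IH _ b1 I1.
exists (t + t').+1, st2; split=> //.
  by apply: ExecWhileT ex ex'; rewrite (Hp m.+1).
rewrite mulSn; lia.
Qed.

Lemma reaches_push B r b st : bounded B st -> size (st r) <= B ->
  reaches B 2 (Push r b) st (fun st' => st' =1 upd st r (b :: st r)).
Proof.
move=> bst le_B; exists 2, (upd st r (b :: st r)); split=> //; first exact: ExecPush.
by move=> i; rewrite /upd; case: eqP.
Qed.

Lemma reaches_pop B r st : bounded B st ->
  reaches B 1 (Pop r) st (fun st' => st' =1 upd st r (behead (st r))).
Proof.
move=> bst; exists 1, (upd st r (behead (st r))); split=> //; first exact: ExecPop.
by move=> i; rewrite /upd; case: eqP => // _; rewrite size_behead (leq_trans (leq_pred _)).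
Qed.

(** * Clearing and copying stacks *)

Definition clear r := While r isSome (Pop r).

Lemma reaches_clear B r st : bounded B st ->
  reaches B (B * 2 + 3) (clear r) st (fun st' => st' =1 upd st r [::]).
Proof.
move=> bst.
have := @reaches_while B 1 r isSome (Pop r)
  (fun j st' => (forall i, i != r -> st' i = st i) /\ size (st' r) = j)
  (size (st r)) st bst.
case=> //.
- by move=> j st1 _ [_ <-]; case: (st1 r).
- move=> j st1 b1 [E1 s1]; apply: reachesW (reaches_pop r b1) => // st' _ E.
  split=> [i ne_i|]; first by rewrite E /upd (negPf ne_i) E1.
  by rewrite E /upd eqxx size_behead s1.
move=> t [st' [ex le_t b' [E s0]]]; exists t, st'; split=> //.
  by apply: leq_trans le_t _; have := bst r; lia.
move=> i; rewrite /upd; case: eqP => [->|/eqP/E//]; exact: size0nil.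
Qed.

Definition transfer w (c : bool -> cmd) :=
  While w isSome (Seq (If w (pred1 (Some true)) (c true) (c false)) (Pop w)).

(** [J s] is the invariant when [s] remains to be treated. It must not look at [w] itself, because
    the bit just handled is popped after [J s] has been established. *)
Lemma reaches_transfer B T w c (J : seq bool -> store -> Prop) st :
  bounded B st -> J (st w) st ->
  (forall s st1 st2, (forall i, i != w -> st2 i = st1 i) -> J s st1 -> J s st2) ->
  (forall b s st1, bounded B st1 -> st1 w = b :: s -> J (b :: s) st1 ->
     reaches B T (c b) st1 (fun st' => st' w = b :: s /\ J s st')) ->
  reaches B (B.+1 * (T.+3)).+1 (transfer w c) st
    (fun st' => st' w = [::] /\ J [::] st').
Proof.
move=> bst Jst JE Hc.
have H := @reaches_while B T.+2 w isSome
  (Seq (If w (pred1 (Some true)) (c true) (c false)) (Pop w))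
  (fun j st' => size (st' w) = j /\ J (st' w) st') (size (st w)) st bst.
apply: reachesW (H _ _ _).
- by rewrite ltnS leq_mul2r bst orbT.
- by move=> st' _ [/size0nil-> ?].
- by [].
- by move=> j st1 _ [<- _]; case: (st1 w).
move=> j st1 b1 [sz J1]; rewrite -(addn1 T.+1).
case Ew: (st1 w) sz J1 => [//|b s] /= [sz] J1.
apply: (@reaches_seq _ _ _ _ _ _ (fun st' => st' w = b :: s /\ J s st')).
  by apply: reaches_if; rewrite Ew; case: b Ew J1 => //= Ew J1 _; apply: Hc.
move=> st2 b2 [E2 J2]; apply: reachesW (reaches_pop w b2) => // st3 _ E3.
rewrite E3 /upd eqxx E2; split=> //=; apply: JE J2 => i ne_i.
by rewrite E3 /upd (negPf ne_i).
Qed.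

(** Unloading a stack reverses and destroys it; a second unloading, from [t], restores the order and
    refills [w] along with [v]. *)
Definition copy w v t :=
  Seq (Seq (clear v) (clear t))
    (Seq (transfer w (Push t)) (transfer t (fun b => Seq (Push w b) (Push v b)))).

Lemma reaches_copy B w v t st : bounded B st -> w != v -> w != t -> v != t ->
  reaches B (B * 16 + 20) (copy w v t) st
    (fun st' => st' =1 upd (upd st t [::]) v (st w)).
Proof.
move=> bst ne_wv ne_wt ne_vt.
have -> : B * 16 + 20 = (B * 2 + 3 + (B * 2 + 3)) +
  ((B.+1 * 5).+1 + (B.+1 * 7).+1) by lia.
have ne_tw : t != w by rewrite eq_sym.
have ne_vw : v != w by rewrite eq_sym.
have ne_tv : t != v by rewrite eq_sym.
pose others st1 := forall i, i \notin [:: w; v; t] -> st1 i = st i.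
apply: (@reaches_seq _ _ _ _ _ _ (fun st1 =>
    [/\ st1 w = st w, st1 v = [::], st1 t = [::] & others st1])).
  apply: reaches_seq (reaches_clear v bst) _ => st1 b1 E1.
  apply: reachesW (reaches_clear t b1) => // st2 _ E2; split.
  - by rewrite E2 /upd (negPf ne_wt) E1 /upd (negPf ne_wv).
  - by rewrite E2 /upd (negPf ne_vt) E1 /upd eqxx.
  - by rewrite E2 /upd eqxx.
  move=> i; rewrite !inE !negb_or => /and3P[_ /negPf ne_v /negPf ne_t].
  by rewrite E2 /upd ne_t E1 /upd ne_v.
move=> st1 b1 [Ew Ev Et Eo].
apply: (@reaches_seq _ _ _ _ _ _ (fun st' => st' w = [::] /\
    [/\ catrev (st' t) [::] = st w, st' v = [::] & others st'])).
  apply: (@reaches_transfer _ _ _ _ (fun s st' =>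
    [/\ catrev (st' t) s = st w, st' v = [::] & others st'])) => //.
  - by rewrite Et.
  - move=> s st2 st3 E3 [Et2 Ev2 Eo2]; rewrite !E3 //; split=> //.
    by move=> i Hi; rewrite E3 ?Eo2 //; apply: contraNneq Hi => ->; rewrite !inE eqxx ?orbT.
  (* What is on [t] and what is still on [w] make up the original stack, so the push cannot exceed
     the bound. *)
  move=> b s st2 b2 Ew2 [Et2 Ev2 Eo2]; have le_t: size (st2 t) <= B.
    by have := bst w; rewrite -Et2 catrevE size_cat size_rev /=; lia.
  apply: reachesW (reaches_push b b2 le_t) => // st3 _ E3.
  rewrite !E3 /upd (negPf ne_wt) eqxx (negPf ne_vt); split=> //; split=> //.
  move=> i Hi; rewrite E3 /upd; case: eqVneq => [Ei|_]; last exact: Eo2.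
  by rewrite Ei !inE eqxx !orbT in Hi.
move=> {st1 b1 Ew Ev Et Eo} st1 b1 [Ew [Et Ev Eo]].
have := @reaches_transfer B 4 t (fun b => Seq (Push w b) (Push v b)) (fun s st' =>
    [/\ st' v = st' w, catrev s (st' w) = st w & others st']) _ b1.
move=> H; apply: reachesW (H _ _ _) => //.
- move=> st2 _ [Et2 [Ev2 Ew2 Eo2]] i; rewrite /upd; case: eqP => [->|/eqP ne_iv].
    by rewrite Ev2.
  case: eqP => [->//|/eqP ne_it].
  case: (eqVneq i w) => [->//|ne_iw].
  by apply: Eo2; rewrite !inE (negPf ne_iv) (negPf ne_it) (negPf ne_iw).
- by split=> //; rewrite ?Ev ?Ew.
- move=> s st2 st3 E3 [Ev2 Ew2 Eo2]; rewrite !E3 //; split=> //.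
  by move=> i Hi; rewrite E3 ?Eo2 //; apply: contraNneq Hi => ->; rewrite !inE eqxx ?orbT.
move=> b s st2 b2 Et2 [Ev2 Ew2 Eo2]; have le_w: size (st2 w) <= B.
  by have := bst w; rewrite -Ew2 catrevE size_cat size_rev /=; lia.
have le_v : size (st2 v) <= B by rewrite Ev2.
apply: (@reaches_seq _ 2 2 _ _ _ _ _ (reaches_push b b2 le_w)) => st3 b3 E3.
have le_v3 : size (st3 v) <= B by rewrite E3 /upd (negPf ne_vw).
apply: reachesW (reaches_push b b3 le_v3) => // st4 _ E4.
rewrite !E4 /upd eqxx (negPf ne_wv) !E3 /upd eqxx (negPf ne_vw).
rewrite (negPf ne_tv) (negPf ne_tw) Ev2; split=> //; split=> //.
move=> i Hi; rewrite E4 /upd; case: (eqVneq i v) => [Ei|_].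
  by rewrite Ei !inE eqxx orbT in Hi.
rewrite E3 /upd; case: (eqVneq i w) => [Ei|_]; last exact: Eo2.
by rewrite Ei !inE eqxx in Hi.
Qed.

(** * Feasible functions and their closure properties *)

Fixpoint env k (st : store) : seq (seq bool) :=
  if k is k'.+1 then st k' :: env k' st else [::].

Lemma eq_env k st st' : (forall i, i < k -> st i = st' i) -> env k st = env k st'.
Proof.
elim: k => //= k IH E; rewrite E // IH // => i lt_i; apply: E; exact: ltnW.
Qed.

(* The arguments are in the registers below [k], the newest one first in [env];
   the result goes to register [k], and the registers above are scratch.  The
   bound [B.+1] leaves room for one-bit constants when all inputs are empty. *)
Definition feasible k (f : seq (seq bool) -> seq bool) :=
  exists c (p : {poly nat}), forall st B, bounded B st ->
    reaches B p.[B]%R c st (fun st' =>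
      (forall i, i < k -> st' i = st i) /\ st' k = f (env k st)).

Lemma feasible_ext k f g : f =1 g -> feasible k f -> feasible k g.
Proof.
move=> E [c [p H]]; exists c, p => st B bst.
by apply: reachesW (H st B bst) => // st' _ [E1 E2]; rewrite E2 E.
Qed.

Lemma polytime_feasible n f : feasible n f ->
  polytime n (fun xs => ohead (f (rev xs)) == Some true).
Proof.
case=> c [p H]; have [m below] := regs_below_ex c.
(* The additional step is the verdict; the total input length bounds every register. *)
exists (machine n m c), (p + 1)%R => xs size_xs.
set N := sumn _; have b0 : bounded N (nth [::] xs).
  move=> r; case: (ltnP r (size xs)) => [lt_r|ge_r]; last by rewrite nth_default.
  apply: leqW; rewrite /N -(cat_take_drop r xs) map_cat sumn_cat.
  by rewrite (drop_nth [::]) //= nth_cat size_take lt_r ltnn subnn /= addnCA leq_addr.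
have [t [st' [ex le_t _ [_ Est]]]] := H _ _ b0.
rewrite (machine_result (t := t) (st := nth [::] xs) (st' := st')) //.
- congr (Some (ohead _ == _)); rewrite Est; congr f.
  rewrite -[in RHS](take_oversize (leqnn (size xs))) size_xs.
  have: n <= size xs by rewrite size_xs.
  elim: (n) => [|k IH] /= lt_k; first by rewrite take0.
  by rewrite (take_nth [::]) // rev_rcons IH // ltnW.
- by apply: regs_belowW below; lia.
- by rewrite hornerD hornerC -[(_ + 1)%R]/(_ + 1) addn1 ltnS.
Qed.

Lemma feasible_var k j : j < k -> feasible k (fun e => head [::] (iter j behead e)).
Proof.
move=> lt_j; exists (copy (k - j.+1) k k.+1), ('X * 16%N%:P + 20%N%:P)%R => st B bst.
apply: reachesW (reaches_copy bst _ _ _); try lia.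
  by rewrite hornerD hornerM hornerX !hornerC.
move=> st' _ E; split=> [i lt_i|].
  by rewrite E /upd !ltn_eqF // ltnS ltnW.
rewrite E /upd eqxx; elim: k j lt_j {E} => // k IH [|j] lt_j; first by rewrite subn1.
by rewrite iterSr /= subSS IH.
Qed.

Lemma feasible_const k s : size s <= 1 -> feasible k (fun _ => s).
Proof.
case: s => [|b [|//]] _.
  exists (clear k), ('X * 2%N%:P + 3%N%:P)%R => st B bst.
  apply: reachesW (reaches_clear k bst).
    by rewrite hornerD hornerM hornerX !hornerC.
  move=> st' _ E; split=> [i lt_i|]; rewrite E /upd ?eqxx //.
  by rewrite ltn_eqF.
exists (Seq (clear k) (Push k b)), ('X * 2%N%:P + 3%N%:P + 2%N%:P)%R => st B bst.
rewrite !hornerD hornerM hornerX !hornerC.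
apply: reaches_seq (reaches_clear k bst) _ => st1 b1 E1.
apply: reachesW (reaches_push b b1 _) => //; last by rewrite E1 /upd eqxx.
move=> st' _ E; split=> [i lt_i|]; last by rewrite E /upd eqxx E1 /upd eqxx.
by rewrite E /upd ltn_eqF // E1 /upd ltn_eqF.
Qed.

(** The value of [f] is left in register [k], where [g] finds it as its newest argument; the result
    of [g] is then copied down by one register. *)
Lemma feasible_let k f g : feasible k f -> feasible k.+1 g -> feasible k (fun e => g (f e :: e)).
Proof.
move=> [c [p Hc]] [d [q Hd]].
exists (Seq (Seq c d) (copy k.+1 k k.+2)), (p + q + ('X * 16%N%:P + 20%N%:P))%R => st B bst.
rewrite !hornerD hornerM hornerX !hornerC.
apply: (@reaches_seq _ _ _ _ _ _ (fun st' => (forall i, i < k -> st' i = st i) /\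
    st' k.+1 = g (f (env k st) :: env k st))).
  apply: reaches_seq (Hc _ _ bst) _ => st1 b1 [E1 E1k].
  apply: reachesW (Hd _ _ b1) => // st2 _ [E2 E2k]; split=> [i lt_i|].
    by rewrite E2 ?E1 // ltnW.
  by rewrite E2k /= E1k; congr (g (_ :: _)); apply: eq_env.
move=> st1 b1 [E1 E1k]; apply: reachesW (reaches_copy b1 _ _ _); try lia.
move=> st' _ E; split=> [i lt_i|]; rewrite E /upd ?eqxx //.
by rewrite !ifN_eq ?E1 //; lia.
Qed.

Lemma feasible_behead k f : feasible k f -> feasible k (fun e => behead (f e)).
Proof.
move=> [c [p Hc]]; exists (Seq c (Pop k)), (p + 1%N%:P)%R => st B bst.
rewrite !hornerD !hornerC.
apply: reaches_seq (Hc _ _ bst) _ => st1 b1 [E1 E1k].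
apply: reachesW (reaches_pop k b1) => // st' _ E.
split=> [i lt_i|]; rewrite E /upd ?eqxx ?E1k //.
by rewrite ifN_eq ?E1 //; lia.
Qed.

Lemma feasible_if k (p : option bool -> bool) f g h : feasible k f -> feasible k g -> feasible k h ->
  feasible k (fun e => if p (ohead (f e)) then g e else h e).
Proof.
move=> [c [pc Hc]] [d [pd Hd]] [d' [pd' Hd']].
exists (Seq c (If k p d d')), (pc + (pd + pd' + 1%N%:P))%R => st B bst.
rewrite !hornerD !hornerC.
apply: reaches_seq (Hc _ _ bst) _ => st1 b1 [E1 E1k]; rewrite -E1k -(eq_env E1).
rewrite -[(_ + 1%N)%R]/(_ + 1) addn1; apply: reaches_if => Hp; rewrite ?Hp ?(negPf Hp).
  apply: reachesW (Hd _ _ b1) => [|st' _ [E Ek]]; first exact: leq_addr.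
  by split=> // i lt_i; rewrite E // E1.
apply: reachesW (Hd' _ _ b1) => [|st' _ [E Ek]]; first exact: leq_addl.
by split=> // i lt_i; rewrite E // E1.
Qed.

(** The two ways to control a loop: by the whole of a string, or by the number that it starts
    with. *)
Definition run_length (z : bool) (s : seq bool) := if z then size s else find negb s.

(** Register [k] is the counter and register [k.+1] the accumulator. Iteration stays polynomial
    because the stacks obey the same bound [B] after each round as before it, so one cost bound
    serves all rounds. *)
Lemma feasible_iter z k a b G : feasible k a -> feasible k.+1 (fun e => b (behead e)) ->
  feasible k.+2 (fun e => G (head [::] e) (behead (behead e))) ->
  feasible k (fun e => iter (run_length z (a e)) (fun v => G v e) (b e)).
Proof.
move=> [c [pc Hc]] [d [pd Hd]] [g [pg Hg]].
pose body := Seq (Seq g (copy k.+2 k.+1 k.+3)) (Pop k).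
have [cp cpE] : exists cp : {poly nat}, forall B, cp.[B]%R = B * 16 + 20.
  by exists ('X * 16%N%:P + 20%N%:P)%R => B; rewrite hornerD hornerM hornerX !hornerC.
exists (Seq (Seq (Seq c d) (While k (fun s => if z then isSome s else s == Some true) body))
         (copy k.+1 k k.+2)),
  (pc + pd + (('X + 1%N%:P) * (pg + cp + 1%N%:P + 1%N%:P) + 1%N%:P) + cp)%R => st B bst.
rewrite !hornerD cpE !hornerM hornerD hornerX !hornerD cpE !hornerC.
set e := env k st.
apply: (@reaches_seq _ _ _ _ _ _ (fun st' => (forall i, i < k -> st' i = st i) /\
    st' k.+1 = iter (run_length z (a e)) (fun v => G v e) (b e))); last first.
  move=> st1 b1 [E1 E1k]; apply: reachesW (reaches_copy b1 _ _ _); try lia.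
  move=> st' _ E; split=> [i lt_i|]; rewrite E /upd ?eqxx //.
  by rewrite !ifN_eq ?E1 //; lia.
apply: (@reaches_seq _ _ _ _ _ _ (fun st' => [/\ forall i, i < k -> st' i = st i,
    st' k = a e & st' k.+1 = b e])).
  apply: reaches_seq (Hc _ _ bst) _ => st1 b1 [E1 E1k].
  apply: reachesW (Hd _ _ b1) => // st2 _ [E2 E2k]; split=> [i lt_i||].
  - by rewrite E2 ?E1 // ltnW.
  - by rewrite E2.
  by rewrite E2k /= (eq_env E1).
move=> st1 b1 [E1 E1k E1k1].
have H := @reaches_while B (pg.[B]%R + (B * 16 + 20) + 1) k
  (fun s => if z then isSome s else s == Some true) body
  (fun j st' => [/\ forall i, i < k -> st' i = st i, run_length z (st' k) = j &
     iter j (fun v => G v e) (st' k.+1) = iter (run_length z (a e)) (fun v => G v e) (b e)])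
  (run_length z (a e)) st1 b1.
apply: reachesW (H _ _ _).
- rewrite -[X in _ <= X]/((B + 1) * (pg.[B]%R + (B * 16 + 20) + 1 + 1) + 1) !addn1 ltnS leq_mul //.
  rewrite -E1k; apply: leq_trans (b1 k); rewrite /run_length; case: (z) => //; exact: find_size.
- by move=> st' _ [E Ek /= Ek1].
- by rewrite E1k E1k1.
- move=> j st2 _ [_ <- _]; case: (st2 k) => [|[] s]; rewrite /run_length; by case: (z).
move=> j st2 b2 [E2 E2k E2k1].
apply: (@reaches_seq _ _ _ _ _ _ (fun st' => [/\ forall i, i < k -> st' i = st i,
    st' k = st2 k & st' k.+1 = G (st2 k.+1) e])).
  apply: reaches_seq (Hg _ _ b2) _ => st3 b3 [E3 E3k].
  apply: reachesW (reaches_copy b3 _ _ _); try lia.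
  move=> st' _ E; split=> [i lt_i||]; rewrite E /upd ?eqxx //.
  - by rewrite !ifN_eq ?E3 ?E2 //; lia.
  - by rewrite !ifN_eq ?E3 //; lia.
  by rewrite E3k /= (eq_env E2).
move=> st3 b3 [E3 E3k E3k1]; apply: reachesW (reaches_pop k b3) => // st' _ E.
split=> [i lt_i||].
- by rewrite E /upd ifN_eq ?E3 //; lia.
- rewrite E /upd eqxx E3k; move: E2k; rewrite /run_length; case: (st2 k) => [|b' s]; case: (z) => //=.
    by move=> [].
  by case: b' => //= -[].
by rewrite E /upd gtn_eqF // E3k1 -iterSr.
Qed.

(** * Renaming registers, to make room for further arguments *)

Fixpoint rename (h : nat -> nat) (c : cmd) : cmd :=
  match c with
  | Push r b => Push (h r) b
  | Pop r => Pop (h r)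
  | Seq c d => Seq (rename h c) (rename h d)
  | If r p c d => If (h r) p (rename h c) (rename h d)
  | While r p c => While (h r) p (rename h c)
  end.

Lemma exec_rename h k c st t st' : injective h -> (forall r, h r != k) ->
  exec c st t st' -> forall st2, (forall r, st2 (h r) = st r) ->
  exists st2', [/\ exec (rename h c) st2 t st2', forall r, st2' (h r) = st' r &
    st2' k = st2 k].
Proof.
move=> inj_h hk; elim=> {c st t st'} /=.
- move=> st r b st2 E; exists (upd st2 (h r) (b :: st2 (h r))).
  split; [exact: ExecPush| |by rewrite /upd eq_sym (negPf (hk r))].
  by move=> i; rewrite /upd (inj_eq inj_h) !E.
- move=> st r st2 E; exists (upd st2 (h r) (behead (st2 (h r)))).
  split; [exact: ExecPop| |by rewrite /upd eq_sym (negPf (hk r))].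
  by move=> i; rewrite /upd (inj_eq inj_h) !E.
- move=> c d st t st1 t' st' _ IHc _ IHd st2 /IHc[st3 [ex3 /IHd[st4 [ex4 E4 K4]] K3]].
  by exists st4; split; [exact: ExecSeq ex3 ex4| |rewrite K4].
- move=> st r p c d t st' Hp _ IH st2 E; have [st3 [ex3 E3 K3]] := IH _ E.
  by exists st3; split=> //; apply: ExecIfT => //; rewrite E.
- move=> st r p c d t st' Hp _ IH st2 E; have [st3 [ex3 E3 K3]] := IH _ E.
  by exists st3; split=> //; apply: ExecIfF => //; rewrite E.
- by move=> st r p c Hp st2 E; exists st2; split=> //; apply: ExecWhileF; rewrite E.
move=> st r p c t st1 t' st' Hp _ IHc _ IHd st2 E.
have [st3 [ex3 /IHd[st4 [ex4 E4 K4]] K3]] := IHc _ E.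
by exists st4; split; [apply: ExecWhileT ex3 ex4; rewrite E| |rewrite K4].
Qed.

(** [bump j] skips register [j]: the renamed program runs on the others and leaves that place free
    for a new argument. *)
Lemma feasible_rename k j (f g : seq (seq bool) -> seq bool) : j <= k -> feasible k f ->
  (forall st, g (env k.+1 st) = f (env k (fun r => st (bump j r)))) -> feasible k.+1 g.
Proof.
move=> le_jk [c [p Hc]] fg; exists (rename (bump j) c), p => st B bst.
have [|t [st' [ex le_t b' [E Ek]]]] := Hc (fun r => st (bump j r)) B; first by move=> r /=.
have [||st2 [ex2 E2 K2]] := exec_rename (can_inj (@bumpK j)) _ ex (st2 := st) (k := j) => //.
  by move=> r; rewrite eq_sym neq_bump.
exists t, st2; split=> //.
- move=> r; case: (eqVneq r j) => [->|ne_r]; first by rewrite K2.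
  by have := unbumpKcond j r; rewrite (negPf ne_r) add0n => <-; rewrite E2.
split=> [i lt_i|].
  case: (eqVneq i j) => [->|ne_i]; first by rewrite K2.
  have Ei := unbumpKcond j i; rewrite (negPf ne_i) add0n in Ei.
  rewrite -Ei E2 E //=; move: ne_i lt_i; rewrite /unbump; lia.
by rewrite fg -Ek -E2 /bump le_jk.
Qed.

Lemma feasible_weaken k f : feasible k f -> feasible k.+1 (fun e => f (behead e)).
Proof.
move=> cf; apply: (feasible_rename (leqnn k) cf) => st /=; congr f.
by apply: eq_env => i lt_i; rewrite /= /bump leqNgt lt_i.
Qed.

Lemma feasible_weaken2 k f : feasible k.+1 f ->
  feasible k.+2 (fun e => f (head [::] e :: behead (behead e))).
Proof.
move=> cf; apply: (feasible_rename (leqnSn k) cf) => st /=; rewrite /bump leqnn; congr (f (_ :: _)).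
by apply: eq_env => i lt_i; rewrite /= /bump leqNgt lt_i.
Qed.

(** * Numbers and truth values represented by strings *)

Definition hd (s : seq bool) := head false s.
Definition num (s : seq bool) := find negb s.

(** A representing string only has to start with the right number or bit, so results never have to
    be normalised. *)
Definition feasibleN k (f : seq (seq bool) -> nat) :=
  exists2 g, feasible k g & forall e, num (g e) = f e.
Definition feasibleb k (f : seq (seq bool) -> bool) :=
  exists2 g, feasible k g & forall e, hd (g e) = f e.

Lemma feasible_cond k f g h : feasibleb k f -> feasible k g -> feasible k h ->
  feasible k (fun e => if f e then g e else h e).
Proof.
case=> f' cf' E cg ch.
apply: feasible_ext (feasible_if (pred1 (Some true)) cf' cg ch) => e /=.
by rewrite -E; case: (f' e) => [|[] s].
Qed.

Lemma feasibleb_hd k f : feasible k f -> feasibleb k (fun e => hd (f e)).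
Proof. by exists f. Qed.

Lemma feasibleN_num k f : feasible k f -> feasibleN k (fun e => num (f e)).
Proof. by exists f. Qed.

Lemma feasibleb_and k f g : feasibleb k f -> feasibleb k g -> feasibleb k (fun e => f e && g e).
Proof.
move=> cf [g' cg' E]; exists (fun e => if f e then g' e else [::]).
  by apply: feasible_cond => //; apply: feasible_const.
by move=> e; case: (f e).
Qed.

Lemma feasibleb_not k f : feasibleb k f -> feasibleb k (fun e => ~~ f e).
Proof.
move=> cf; exists (fun e => if f e then [::] else [:: true]).
  by apply: feasible_cond => //; apply: feasible_const.
by move=> e; case: (f e).
Qed.

Lemma feasibleb_imply k f g : feasibleb k f -> feasibleb k g -> feasibleb k (fun e => f e ==> g e).
Proof.
move=> cf [g' cg' E]; exists (fun e => if f e then g' e else [:: true]).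
  by apply: feasible_cond => //; apply: feasible_const.
by move=> e; case: (f e).
Qed.

Lemma feasibleb_eqb k f g : feasibleb k f -> feasibleb k g -> feasibleb k (fun e => f e == g e).
Proof.
move=> cf cg; have [g1 c1 E1] := cg; have [g2 c2 E2] := feasibleb_not cg.
exists (fun e => if f e then g1 e else g2 e); first exact: feasible_cond.
by move=> e; case: (f e); rewrite ?E1 ?E2; case: (g e).
Qed.

Lemma feasible_loop z k a b G : feasible k a -> feasible k b ->
  feasible k.+1 (fun e => G (head [::] e) (behead e)) ->
  feasible k (fun e => iter (run_length z (a e)) (fun v => G v e) (b e)).
Proof.
move=> ca cb cG; apply: feasible_iter => //; first exact: feasible_weaken.
exact: (feasible_weaken2 cG).
Qed.

Lemma feasible_loopN k n b G : feasibleN k n -> feasible k b ->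
  feasible k.+1 (fun e => G (head [::] e) (behead e)) ->
  feasible k (fun e => iter (n e) (fun v => G v e) (b e)).
Proof.
case=> a ca E cb cG.
by apply: feasible_ext (feasible_loop false ca cb cG) => e; rewrite -E.
Qed.

Lemma feasible_app k F f : feasible k.+1 (fun e => F (head [::] e)) -> feasible k f ->
  feasible k (fun e => F (f e)).
Proof. by move=> cF cf; apply: (feasible_let cf cF). Qed.

Definition rest (s : seq bool) := behead (iter (num s) behead s).

Lemma feasible_hd k : feasible k.+1 (head [::]).
Proof. exact: (@feasible_var k.+1 0). Qed.

Lemma feasible_rest k f : feasible k f -> feasible k (fun e => rest (f e)).
Proof.
apply: feasible_app; apply: feasible_behead; apply: feasible_loopN.
- exact/feasibleN_num/feasible_hd.
- exact: feasible_hd.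
exact/feasible_behead/feasible_hd.
Qed.

Lemma feasible_restn k n f : feasibleN k n -> feasible k f -> feasible k (fun e => iter (n e) rest (f e)).
Proof. by move=> cn cf; apply: feasible_loopN cn cf _; apply: feasible_rest; apply: feasible_hd. Qed.

Lemma iter_lt n (b : seq bool) :
  hd (iter n (fun v => if hd v then behead v else v) b) = (n < num b).
Proof.
elim: n b => [|n IH] b; rewrite /num; first by case: b => [|[]].
by rewrite iterSr IH; case: b => [|[] b] //=.
Qed.

(* [if hd v then behead v else v] stops at the end of the block of ones, so both
   numbers are compared even when the block of [n] is not terminated. *)
Lemma feasibleb_lt k m n : feasibleN k m -> feasibleN k n -> feasibleb k (fun e => m e < n e).
Proof.
move=> cm [b cb E].
exists (fun e => iter (m e) (fun v => if hd v then behead v else v) (b e)).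
  apply: feasible_loopN => //; apply: feasible_cond; last exact: feasible_hd.
    exact/feasibleb_hd/feasible_hd.
  exact/feasible_behead/feasible_hd.
by move=> e; rewrite iter_lt E.
Qed.

Lemma feasibleb_eq k m n : feasibleN k m -> feasibleN k n -> feasibleb k (fun e => m e == n e).
Proof.
move=> cm cn; have [f cf E] := feasibleb_and (feasibleb_not (feasibleb_lt cm cn)) (feasibleb_not (feasibleb_lt cn cm)).
by exists f => // e; rewrite E -!leqNgt eqn_leq andbC.
Qed.

(* A number is read from a string as the length of its initial block of ones, so
   a suffix of the input serves as a number; the items of a coded list are
   likewise the suffixes starting just after their markers, each item being made
   of [m] numbers. *)
Fixpoint items_rec j m s : seq (seq bool) :=
  if j is j'.+1 then
    if s is true :: s' then s' :: items_rec j' m (iter m rest s') else [::]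
  else [::].

Definition items m s := items_rec (size s) m s.

(** Stationary at the end of a list, so that iterating it as often as the string is long stops
    there, whatever the number of items. *)
Definition skip m s := if hd s then iter m rest (behead s) else s.

Definition after m s := behead (iter (size s) (skip m) s).

Lemma size_restn m s : size (iter m rest s) <= size s.
Proof.
elim: m => //= m; apply: leq_trans; rewrite /rest size_behead.
apply: leq_trans (leq_pred _) _; elim: (num _) => //= n.
by apply: leq_trans; rewrite size_behead leq_pred.
Qed.

(** A search with a single pointer: it freezes on the first item that satisfies [P] and otherwise
    runs to the end, so the answer is the bit under it. *)
Lemma has_items_rec P j m s : size s <= j ->
  has P (items_rec j m s) = hd (iter j (fun v => if hd v && P (behead v) then v else skip m v) s).
Proof.
have stop j' v : hd v = false ->
    hd (iter j' (fun v => if hd v && P (behead v) then v else skip m v) v) = false.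
  by move=> hv; elim: j' => //= j' IH; rewrite IH /= /skip IH.
elim: j s => [|j IH] [|b s] // le_s; first by rewrite stop.
case: b le_s => le_s; last by rewrite stop.
rewrite iterSr [LHS]/= [in RHS]/=; case: ifP => [Ps|_] /=.
  by rewrite [iter _ _ _](_ : _ = true :: s) //; elim: j {IH le_s} => //= j ->; rewrite /= Ps.
by rewrite -IH // (leq_trans (size_restn _ _)).
Qed.

(** The length of an item is a constant or depends on the number of agents. A constant like 3 has no
    string within the size bound when all inputs are empty, so its iteration is unrolled instead. *)
Definition arity k (m : seq (seq bool) -> nat) :=
  forall f, feasible k f -> feasible k (fun e => iter (m e) rest (f e)).

Lemma arityN k m : feasibleN k m -> arity k m.
Proof. by move=> cm f; apply: feasible_restn. Qed.

Lemma arity0 k : arity k (fun _ => 0).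
Proof. by []. Qed.

Lemma arityS k m : arity k m -> arity k (fun e => (m e).+1).
Proof. by move=> cm f cf; apply: feasible_rest; apply: cm. Qed.

Lemma feasible_skip k m f : arity k m -> feasible k f ->
  feasible k (fun e => skip (m e) (f e)).
Proof.
move=> cm cf; apply: feasible_cond => //; first exact: feasibleb_hd.
by apply: cm; apply: feasible_behead.
Qed.

Lemma feasible_after k m f : arity k.+1 (fun e => m (behead e)) -> feasible k f ->
  feasible k (fun e => after (m e) (f e)).
Proof.
move=> cm cf; apply: feasible_behead; apply: (feasible_loop true cf cf).
by apply: feasible_skip => //; apply: feasible_hd.
Qed.

Lemma feasibleb_has k m l P : arity k.+1 (fun e => m (behead e)) -> feasible k l ->
  feasibleb k.+1 (fun e => P (head [::] e) (behead e)) ->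
  feasibleb k (fun e => has (fun v => P v e) (items (m e) (l e))).
Proof.
move=> cm cl [p cp EP].
pose Q v e := hd v && hd (p (behead v :: e)).
exists (fun e => iter (run_length true (l e))
    (fun v => if Q v e then v else skip (m e) v) (l e)); last first.
  by move=> e; rewrite has_items_rec //; congr hd; apply: eq_iter => v; rewrite /Q EP.
have ch : feasible k.+1 (head [::]) := feasible_hd k.
apply: feasible_loop => //; apply: feasible_cond; [|exact: ch|exact: feasible_skip].
apply: feasibleb_and; first exact: feasibleb_hd.
exists (fun e => p (behead (head [::] e) :: behead e)) => //.
exact: (feasible_let (feasible_behead ch) (feasible_weaken2 cp)).
Qed.

Lemma feasibleb_all k m l P : arity k.+1 (fun e => m (behead e)) -> feasible k l ->
  feasibleb k.+1 (fun e => P (head [::] e) (behead e)) ->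
  feasibleb k (fun e => all (fun v => P v e) (items (m e) (l e))).
Proof.
move=> cm cl cP; have [f cf E] := feasibleb_not (feasibleb_has
  (P := fun v e => ~~ P v e) cm cl (feasibleb_not cP)).
by exists f => // e; rewrite E -[RHS]negbK -has_predC.
Qed.

(** With items of no fields, the items of a block of ones are its proper suffixes, that is, all
    smaller numbers. Bounded quantifiers over numbers thus become quantifiers over lists. *)
Lemma num_items s : map num (items 0 s) = rev (iota 0 (num s)).
Proof.
rewrite /items; elim: s => [|[] s IH] //=.
by rewrite IH /num /= -/(num s) -rev_rcons -cats1 -(iotaD 0 _ 1) addn1.
Qed.

Definition alln n (P : pred nat) := all P (iota 0 n).
Definition exn n (P : pred nat) := has P (iota 0 n).

Lemma feasibleb_exn k n P : feasibleN k n ->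
  feasibleb k.+1 (fun e => P (num (head [::] e)) (behead e)) ->
  feasibleb k (fun e => exn (n e) (fun i => P i e)).
Proof.
move=> [g cg En] cP.
have [f cf E] := feasibleb_has (m := fun=> 0) (P := fun v e => P (num v) e) (@arity0 k.+1) cg cP.
by exists f => // e; rewrite E /exn -En -[RHS]has_rev -num_items has_map.
Qed.

Lemma feasibleb_alln k n P : feasibleN k n ->
  feasibleb k.+1 (fun e => P (num (head [::] e)) (behead e)) ->
  feasibleb k (fun e => alln (n e) (fun i => P i e)).
Proof.
move=> [g cg En] cP.
have [f cf E] := feasibleb_all (m := fun=> 0) (P := fun v e => P (num v) e) (@arity0 k.+1) cg cP.
by exists f => // e; rewrite E /alln -En -[RHS]all_rev -num_items all_map.
Qed.

Lemma feasibleb_false k f : feasible k f -> feasibleb k (fun e => f e == [:: false]).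
Proof.
move=> cf; exists (fun e =>
  if ohead (f e) == Some false then if isSome (ohead (behead (f e))) then [::] else [:: true]
  else [::]); last by move=> e; case: (f e) => [|[] [|b s]].
apply: (feasible_if (pred1 (Some false))) => //; last exact: feasible_const.
apply: (feasible_if isSome); [exact: feasible_behead|exact: feasible_const|exact: feasible_const].
Qed.

Lemma feasibleN0 k : feasibleN k (fun _ => 0).
Proof. by exists (fun _ => [::]) => //; apply: feasible_const. Qed.

Lemma feasible_weaken_iter k n f : feasible k f -> feasible (n + k) (fun e => f (iter n behead e)).
Proof. by move=> cf; elim: n => // n /feasible_weaken; apply: feasible_ext => e; rewrite iterSr. Qed.

Lemma feasibleN_weaken_iter k n f : feasibleN k f -> feasibleN (n + k) (fun e => f (iter n behead e)).
Proof. by case=> g /(feasible_weaken_iter n) cg E; exists (fun e => g (iter n behead e)). Qed.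

(** * The first-order condition *)

Definition fld v i := num (iter i rest v).

Definition lists1 l a := has (fun v => num v == a) (items 1 l).
Definition lists2 l a b := has (fun v => (num v == a) && (num (rest v) == b)) (items 2 l).
Definition lists3 l a b c := has (fun v =>
  [&& num v == a, num (rest v) == b & num (rest (rest v)) == c]) (items 3 l).

Definition states g := num g.
Definition actions g := num (rest g).
Definition initial g := num (rest (rest g)).
Definition links g := rest (rest (rest g)).
Definition acts g := after 3 (links g).
Definition edges g := after 3 (acts g).
Definition labels k g := after k.+2 (edges g).
Definition beyond k g := after 2 (labels k g).

(** The conditions on a structure that loops can check. That every available joint action has a
    successor is left to [profile_ok], which treats a single joint action. Equivalence is expressed
    by reflexivity and equal rows for linked states. *)
Definition wf_struct k p g := [&&
  0 < actions g, initial g < states g,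
  all (fun v => [&& num v < k, num (rest v) < states g & num (rest (rest v)) < states g])
    (items 3 (links g)),
  all (fun v => [&& num v < k, num (rest v) < states g & num (rest (rest v)) < actions g])
    (items 3 (acts g)),
  all (fun v => [&& num v < states g, alln k (fun i => fld (rest v) i < actions g) &
    fld (rest v) k < states g]) (items k.+2 (edges g)),
  all (fun v => (num v < states g) && (num (rest v) < p)) (items 2 (labels k g)),
  alln k (fun i => alln (states g) (fun s => lists3 (links g) i s s &&
    alln (states g) (fun t => lists3 (links g) i s t ==>
      alln (states g) (fun u => lists3 (links g) i s u == lists3 (links g) i t u) &&
      alln (actions g) (fun a => lists3 (acts g) i s a == lists3 (acts g) i t a)))),
  alln k (fun i => alln (states g) (fun s => exn (actions g) (lists3 (acts g) i s))) &
  all (fun v => alln k (fun i => lists3 (acts g) i (num v) (fld (rest v) i)))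
    (items k.+2 (edges g))].

Definition profile_ok k g u :=
  alln (states g) (fun s => alln k (fun i => (fld u i < actions g) && lists3 (acts g) i s (fld u i)) ==>
    has (fun v => (num v == s) && alln k (fun i => fld (rest v) i == fld u i))
      (items k.+2 (edges g))).

Definition agents x := num x.
Definition atoms x := num (rest x).
Definition struct1 x := rest (rest x).
Definition struct2 x := beyond (agents x) (struct1 x).
Definition members x := beyond (agents x) (struct2 x).
Definition point1 x := after 1 (members x).
Definition point2 x := rest (point1 x).

(* The first conjunct makes the last number terminated and final; all earlier
   pieces are then complete, since reading past the end yields the empty string. *)
Definition wf_instance x := [&&
  iter (num (point2 x)) behead (point2 x) == [:: false],
  0 < agents x, wf_struct (agents x) (atoms x) (struct1 x),
  wf_struct (agents x) (atoms x) (struct2 x),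
  all (fun v => num v < agents x) (items 1 (members x)),
  num (point1 x) < states (struct1 x) & num (point2 x) < states (struct2 x)].

Definition group_link k m g s t := exn k (fun i => lists1 m i && lists3 (links g) i s t).

Definition closed_upto k m g z n := alln (states g) (fun s => lists1 z s ==>
  alln (states g) (fun t => lists1 z t ==>
    alln (states g) (fun u => group_link k m g t u ==> lists1 z u)) ==>
  alln (states g) (fun t => lists2 n s t ==> lists1 z t)).

Definition closed_links k m g n := alln (states g) (fun s => lists2 n s s &&
  alln (states g) (fun t => lists2 n s t ==>
    alln (states g) (fun u => group_link k m g t u ==> lists2 n s u))).

Definition static_ok k p m g g' r n :=
  alln (states g) (fun q => alln (states g') (fun q' => lists2 r q q' ==> [&&
    alln p (fun a => lists2 (labels k g) q a == lists2 (labels k g') q' a),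
    alln k (fun i => lists1 m i ==> alln (states g') (fun s' => lists3 (links g') i q' s' ==>
      exn (states g) (fun s => lists3 (links g) i q s && lists2 r s s'))) &
    alln (states g) (fun q2 => lists2 r q2 q' ==> lists2 n q q2)])).

(** The last clause is uniformity and, with [t] equal to [s], uniqueness of the listed action.
    Outside the neighbourhood of [q] the list is unconstrained. *)
Definition strategy_ok k m g n q f :=
  alln k (fun i => lists1 m i ==> alln (states g) (fun s => lists2 n q s ==>
    exn (actions g) (lists3 f i s) &&
    alln (actions g) (fun a => lists3 f i s a ==> lists3 (acts g) i s a &&
      alln (states g) (fun t => lists2 n q t && lists3 (links g) i s t ==>
        alln (actions g) (fun b => lists3 f i t b ==> (a == b)))))).

Definition follows k m f v := alln k (fun i => lists1 m i ==> lists3 f i (num v) (fld (rest v) i)).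

(** The premise filters the challenges: unless they consist of two related states and a strategy,
    any response is accepted. *)
Definition dynamic_ok k m g g' r n n' q q' f w :=
  [&& q < states g, q' < states g', lists2 r q q' & strategy_ok k m g n q f] ==>
  strategy_ok k m g' n' q' w &&
  alln (states g) (fun s => alln (states g') (fun s' =>
    [&& lists2 n q s, lists2 n' q' s' & lists2 r s s'] ==>
    all (fun v' => (num v' == s') && follows k m w v' ==>
      has (fun v => [&& num v == s, follows k m f v & lists2 r (fld (rest v) k) (fld (rest v') k)])
        (items k.+2 (edges g))) (items k.+2 (edges g')))).

(** The same [u2] feeds both directions, with the two states exchanged: its tail is tried as a
    strategy in either structure. *)
Definition verifier_aux k p m g g' r r' n n' q q' u2 u3 u5 := [&&
  closed_links k m g n, closed_links k m g' n',
  alln (states g) (fun s => alln (states g') (fun s' => lists2 r s s' == lists2 r' s' s)),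
  static_ok k p m g g' r n, static_ok k p m g' g r' n', lists2 r q q',
  profile_ok k g u2, profile_ok k g' u2, closed_upto k m g u2 n, closed_upto k m g' u2 n',
  dynamic_ok k m g g' r n n' (num u2) (num (rest u2)) (rest (rest u2)) u3 &
  dynamic_ok k m g' g r' n' n (num (rest u2)) (num u2) (rest (rest u2)) u5].

Definition verifier x u1 u2 u3 u5 := wf_instance x &&
  verifier_aux (agents x) (atoms x) (members x) (struct1 x) (struct2 x)
    u1 (after 2 u1) (after 2 (after 2 u1)) (after 2 (after 2 (after 2 u1)))
    (num (point1 x)) (num (point2 x)) u2 u3 u5.

(** * Feasibility of the condition, read off its syntax *)

Ltac by_weakening H :=
  first [ exact H
        | exact (feasible_weaken_iter 1 H) | exact (feasible_weaken_iter 2 H)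
        | exact (feasible_weaken_iter 3 H) | exact (feasible_weaken_iter 4 H)
        | exact (feasible_weaken_iter 5 H) | exact (feasible_weaken_iter 6 H)
        | exact (feasibleN_weaken_iter 1 H) | exact (feasibleN_weaken_iter 2 H)
        | exact (feasibleN_weaken_iter 3 H) | exact (feasibleN_weaken_iter 4 H)
        | exact (feasibleN_weaken_iter 5 H) | exact (feasibleN_weaken_iter 6 H) ].

Ltac feasible_step := cbv beta; lazymatch goal with
  | |- feasible _ (head [::]) => exact: feasible_hd
  | |- feasible ?k (fun e => head [::] _) =>
      first [ exact (@feasible_var k 0 isT) | exact (@feasible_var k 1 isT)
            | exact (@feasible_var k 2 isT) | exact (@feasible_var k 3 isT)
            | exact (@feasible_var k 4 isT) | exact (@feasible_var k 5 isT) ]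
  | |- feasible _ (fun e => rest _) => apply: feasible_rest
  | |- feasible _ (fun e => iter (@?n e) behead (@?f e)) =>
      refine (feasible_loopN (n := n) (b := f) (G := fun v _ => behead v) _ _ _)
  | |- feasible _ (fun e => behead _) => apply: feasible_behead
  | |- feasible _ (fun e => iter _ rest _) => apply: feasible_restn
  | |- feasible _ (fun e => after (@?m e) (@?f e)) =>
      refine (@feasible_after _ m f _ _)
  | |- arity _ (fun e => _.+1) => apply: arityS
  | |- arity _ (fun e => 0) => exact: arity0
  | |- arity _ _ => apply: arityN
  | |- feasibleN _ (fun e => num _) => apply: feasibleN_num
  | |- feasibleN _ (fun e => 0) => exact: feasibleN0
  | |- feasibleb _ (fun e => _ && _) => apply: feasibleb_and
  | |- feasibleb _ (fun e => _ ==> _) => apply: feasibleb_imply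
  | |- feasibleb _ (fun e => ~~ _) => apply: feasibleb_not
  | |- feasibleb _ (fun e => _ < _) => apply: feasibleb_lt
  | |- feasibleb _ (fun e => _ == _) =>
      first [ apply: feasibleb_eq | apply: feasibleb_eqb | apply: feasibleb_false ]
  | |- feasibleb _ (fun e => alln (@?n e) (@?P e)) =>
      refine (@feasibleb_alln _ n (fun i e => P e i) _ _)
  | |- feasibleb _ (fun e => exn (@?n e) (@?P e)) =>
      refine (@feasibleb_exn _ n (fun i e => P e i) _ _)
  | |- feasibleb _ (fun e => all (@?P e) (items (@?m e) (@?l e))) =>
      refine (@feasibleb_all _ m l (fun i e => P e i) _ _ _)
  | |- feasibleb _ (fun e => has (@?P e) (items (@?m e) (@?l e))) =>
      refine (@feasibleb_has _ m l (fun i e => P e i) _ _ _)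
  | H : feasible _ ?f |- feasible _ (fun e => ?f _) => by_weakening H
  | H : feasibleN _ ?f |- feasibleN _ (fun e => ?f _) => by_weakening H
  | H : feasible _ ?f |- feasible _ ?f => exact H
  | H : feasibleN _ ?f |- feasibleN _ ?f => exact H
  end.

Section Feasible.
Variable k : nat.

Lemma feasibleN_fld v i : feasible k v -> feasibleN k i -> feasibleN k (fun e => fld (v e) (i e)).
Proof. by move=> cv ci; rewrite /fld; repeat feasible_step. Qed.

Lemma feasibleb_lists1 l a : feasible k l -> feasibleN k a ->
  feasibleb k (fun e => lists1 (l e) (a e)).
Proof. by move=> cl ca; rewrite /lists1; repeat feasible_step. Qed.

Lemma feasibleb_lists2 l a b : feasible k l -> feasibleN k a -> feasibleN k b ->
  feasibleb k (fun e => lists2 (l e) (a e) (b e)).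
Proof. by move=> *; rewrite /lists2; repeat feasible_step. Qed.

Lemma feasibleb_lists3 l a b c : feasible k l -> feasibleN k a -> feasibleN k b -> feasibleN k c ->
  feasibleb k (fun e => lists3 (l e) (a e) (b e) (c e)).
Proof. by move=> *; rewrite /lists3; repeat feasible_step. Qed.

Lemma feasibleN_states g : feasible k g -> feasibleN k (fun e => states (g e)).
Proof. by move=> *; rewrite /states; repeat feasible_step. Qed.

Lemma feasibleN_actions g : feasible k g -> feasibleN k (fun e => actions (g e)).
Proof. by move=> *; rewrite /actions; repeat feasible_step. Qed.

Lemma feasible_links g : feasible k g -> feasible k (fun e => links (g e)).
Proof. by move=> *; rewrite /links; repeat feasible_step. Qed.

Lemma feasible_acts g : feasible k g -> feasible k (fun e => acts (g e)).
Proof. by move=> *; rewrite /acts /links; repeat feasible_step. Qed.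

Lemma feasible_edges g : feasible k g -> feasible k (fun e => edges (g e)).
Proof. by move=> *; rewrite /edges /acts /links; repeat feasible_step. Qed.

Lemma feasible_labels m g : feasibleN k m -> feasible k g -> feasible k (fun e => labels (m e) (g e)).
Proof. by move=> *; rewrite /labels /edges /acts /links; repeat feasible_step. Qed.

Lemma feasible_beyond m g : feasibleN k m -> feasible k g -> feasible k (fun e => beyond (m e) (g e)).
Proof. by move=> *; rewrite /beyond /labels /edges /acts /links; repeat feasible_step. Qed.

End Feasible.

Ltac feasible_prim := first [ feasible_step | lazymatch goal with
  | |- feasibleN _ (fun e => fld _ _) => apply: feasibleN_fld
  | |- feasibleN _ (fun e => states _) => apply: feasibleN_states
  | |- feasibleN _ (fun e => actions _) => apply: feasibleN_actions
  | |- feasibleb _ (fun e => lists1 _ _) => apply: feasibleb_lists1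
  | |- feasibleb _ (fun e => lists2 _ _ _) => apply: feasibleb_lists2
  | |- feasibleb _ (fun e => lists3 _ _ _ _) => apply: feasibleb_lists3
  | |- feasible _ (fun e => links _) => apply: feasible_links
  | |- feasible _ (fun e => acts _) => apply: feasible_acts
  | |- feasible _ (fun e => edges _) => apply: feasible_edges
  | |- feasible _ (fun e => labels _ _) => apply: feasible_labels
  | |- feasible _ (fun e => beyond _ _) => apply: feasible_beyond
  end ].

Section Feasible.
Variables (k : nat) (m p q q' : seq (seq bool) -> nat).
Variables (g g' l n n' r r' u f w : seq (seq bool) -> seq bool).
Hypotheses (fm : feasibleN k m) (fp : feasibleN k p) (fq : feasibleN k q) (fq' : feasibleN k q').
Hypotheses (fg : feasible k g) (fg' : feasible k g') (fl : feasible k l) (fn : feasible k n)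
  (fn' : feasible k n') (fr : feasible k r) (fr' : feasible k r')
  (fu : feasible k u) (ff : feasible k f) (fw : feasible k w).

Lemma feasibleb_wf_struct : feasibleb k (fun e => wf_struct (m e) (p e) (g e)).
Proof. by rewrite /wf_struct /initial; repeat feasible_prim. Qed.

Lemma feasibleb_profile_ok : feasibleb k (fun e => profile_ok (m e) (g e) (u e)).
Proof. by rewrite /profile_ok; repeat feasible_prim. Qed.

Lemma feasibleb_group_link :
  feasibleb k (fun e => group_link (m e) (l e) (g e) (q e) (q' e)).
Proof. by rewrite /group_link; repeat feasible_prim. Qed.

Lemma feasibleb_follows : feasibleb k (fun e => follows (m e) (l e) (f e) (u e)).
Proof. by rewrite /follows; repeat feasible_prim. Qed.

Lemma feasibleb_static_ok : feasibleb k (fun e =>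
  static_ok (m e) (p e) (l e) (g e) (g' e) (r e) (n e)).
Proof. by rewrite /static_ok; repeat feasible_prim. Qed.

Lemma feasibleb_strategy_ok : feasibleb k (fun e =>
  strategy_ok (m e) (l e) (g e) (n e) (q e) (f e)).
Proof. by rewrite /strategy_ok; repeat feasible_prim. Qed.

End Feasible.

Ltac feasible_formula := repeat first [ feasible_prim | lazymatch goal with
  | |- feasibleb _ (fun e => group_link _ _ _ _ _) => apply: feasibleb_group_link
  | |- feasibleb _ (fun e => follows _ _ _ _) => apply: feasibleb_follows
  | |- feasibleb _ (fun e => strategy_ok _ _ _ _ _ _) => apply: feasibleb_strategy_ok
  | |- feasibleb _ (fun e => wf_struct _ _ _) => apply: feasibleb_wf_struct
  | |- feasibleb _ (fun e => static_ok _ _ _ _ _ _ _) => apply: feasibleb_static_ok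
  | |- feasibleb _ (fun e => profile_ok _ _ _) => apply: feasibleb_profile_ok
  end ].

Lemma feasibleb_closed_upto k m l g u n : feasibleN k m -> feasible k l -> feasible k g ->
  feasible k u -> feasible k n ->
  feasibleb k (fun e => closed_upto (m e) (l e) (g e) (u e) (n e)).
Proof. by move=> *; rewrite /closed_upto; feasible_formula. Qed.

Lemma feasibleb_closed_links k m l g n : feasibleN k m -> feasible k l -> feasible k g ->
  feasible k n -> feasibleb k (fun e => closed_links (m e) (l e) (g e) (n e)).
Proof. by move=> *; rewrite /closed_links; feasible_formula. Qed.

Lemma feasibleb_dynamic_ok k m l g g' r n n' q q' f w :
  feasibleN k m -> feasible k l -> feasible k g -> feasible k g' -> feasible k r ->
  feasible k n -> feasible k n' -> feasibleN k q -> feasibleN k q' -> feasible k f ->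
  feasible k w -> feasibleb k (fun e => dynamic_ok (m e) (l e) (g e) (g' e) (r e) (n e)
    (n' e) (q e) (q' e) (f e) (w e)).
Proof. by move=> *; rewrite /dynamic_ok; feasible_formula. Qed.

Lemma feasibleb_wf_instance k x : feasible k x -> feasibleb k (fun e => wf_instance (x e)).
Proof.
move=> *.
rewrite /wf_instance /point2 /point1 /members /struct2 /struct1 /atoms /agents.
by feasible_formula.
Qed.

Lemma feasibleb_verifier k x u1 u2 u3 u5 : feasible k x -> feasible k u1 -> feasible k u2 ->
  feasible k u3 -> feasible k u5 ->
  feasibleb k (fun e => verifier (x e) (u1 e) (u2 e) (u3 e) (u5 e)).
Proof.
move=> *; apply: feasibleb_and; first exact: feasibleb_wf_instance.
rewrite /verifier_aux /point2 /point1 /members /struct2 /struct1 /atoms /agents.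
repeat first [ apply: feasibleb_closed_links | apply: feasibleb_closed_upto
  | apply: feasibleb_dynamic_ok | progress feasible_formula ].
Qed.

Lemma polytime_verifier : polytime 6 (fun xs =>
  verifier (nth [::] xs 0) (nth [::] xs 1) (nth [::] xs 2) (nth [::] xs 3) (nth [::] xs 5)).
Proof.
(* The newest string comes first in the environment, so [x] sits at depth 5 and [u5] at depth 0;
   depth 1 is [u4]. *)
have [|||||f cf E] := @feasibleb_verifier 6 (fun e => head [::] (iter 5 behead e))
  (fun e => head [::] (iter 4 behead e)) (fun e => head [::] (iter 3 behead e))
  (fun e => head [::] (iter 2 behead e)) (fun e => head [::] (iter 0 behead e));
  try exact: feasible_var.
have [M [p H]] := polytime_feasible cf.
exists M, p => xs size_xs; rewrite H //; congr Some.
transitivity (hd (f (rev xs))); first by case: (f _) => [|[]].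
by rewrite E; case: xs size_xs {H} => [|x0 [|x1 [|x2 [|x3 [|x4 [|x5 [|]]]]]]].
Qed.

Arguments num : simpl never.
Arguments rest : simpl never.

(** * Reading the code of an instance *)

Lemma num_code_nat n s : num (code_nat n ++ s) = n.
Proof. by rewrite /num /code_nat -catA /=; elim: n => //= n ->. Qed.

Lemma rest_code_nat n s : rest (code_nat n ++ s) = s.
Proof.
rewrite /rest num_code_nat /code_nat -catA; set s' := _ ++ s.
by have -> : iter n behead (nseq n true ++ s') = s' by elim: n => // n IH; rewrite iterSr.
Qed.

Lemma num_code_elt (T : finType) (t : T) s : num (code_elt t ++ s) = enum_rank t.
Proof. exact: num_code_nat. Qed.

Lemma rest_code_elt (T : finType) (t : T) s : rest (code_elt t ++ s) = s.
Proof. exact: rest_code_nat. Qed.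

Lemma rest_code_profile (Ag T : finType) (a : {ffun Ag -> T}) s :
  iter #|Ag| rest (code_profile a ++ s) = s.
Proof.
rewrite /code_profile cardE; elim: (enum Ag) => // i l IH.
by rewrite /= -/(size l) -iterS iterSr -catA rest_code_elt.
Qed.

Lemma fld_code_profile (Ag T : finType) (a : {ffun Ag -> T}) i s :
  fld (code_profile a ++ s) (enum_rank i) = enum_rank (a i).
Proof.
rewrite -[in RHS](enum_rankK i) /fld /code_profile.
rewrite (enum_val_nth i); have := ltn_ord (enum_rank i); rewrite [X in _ < X]cardE.
elim: (enum Ag) (nat_of_ord _) => // j l IH [|n] lt_n; first by rewrite -catA num_code_elt.
by rewrite iterSr [flatten _]/= -catA rest_code_elt IH.
Qed.

Lemma code_seq_cons T (code : T -> seq bool) t l s :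
  code_seq code (t :: l) ++ s = true :: code t ++ (code_seq code l ++ s).
Proof. by rewrite /code_seq /= -!catA. Qed.

Section Items.
Variables (T : Type) (code : T -> seq bool) (m : nat).
Hypothesis rest_code : forall t s, iter m rest (code t ++ s) = s.

Lemma has_items_code P Q l s : (forall t s', P (code t ++ s') = Q t) ->
  has P (items m (code_seq code l ++ s)) = has Q l.
Proof.
move=> PQ; suff H j : size (code_seq code l ++ s) <= j ->
    has P (items_rec j m (code_seq code l ++ s)) = has Q l by apply: H.
elim: l j => [|t l IH] [|j]; rewrite ?code_seq_cons //=.
rewrite rest_code PQ ltnS size_cat => le_j; rewrite IH //.
by apply: leq_trans le_j; apply: leq_addl.
Qed.

Lemma all_items_code P Q l s : (forall t s', P (code t ++ s') = Q t) ->
  all P (items m (code_seq code l ++ s)) = all Q l.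
Proof.
move=> PQ; apply: negb_inj; rewrite -!has_predC.
by apply: has_items_code => t s'; rewrite /= PQ.
Qed.

Lemma after_code l s : after m (code_seq code l ++ s) = s.
Proof.
suff H j : size (code_seq code l ++ s) <= j ->
    behead (iter j (skip m) (code_seq code l ++ s)) = s by apply: H.
elim: l j => [|t l IH] j.
  by move=> _; have -> : iter j (skip m) (false :: s) = false :: s by elim: j => // j /= ->.
rewrite code_seq_cons; case: j => // j; rewrite [size _]/= ltnS size_cat => le_j.
rewrite iterSr /skip /= rest_code IH //.
by apply: leq_trans le_j; apply: leq_addl.
Qed.
End Items.

Definition code_pair (T U : finType) (t : T * U) := code_elt t.1 ++ code_elt t.2.

Definition code_triple (T U V : finType) (t : T * U * V) :=
  code_elt t.1.1 ++ code_elt t.1.2 ++ code_elt t.2.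

Lemma cat3A (T : Type) (a b c s : seq T) : (a ++ b ++ c) ++ s = a ++ b ++ c ++ s.
Proof. by rewrite -!catA. Qed.

Lemma rank_eq (T : finType) (t u : T) : ((enum_rank t : nat) == enum_rank u) = (t == u).
Proof. by rewrite -(inj_eq enum_rank_inj). Qed.

Lemma rest_code_pair (T U : finType) (t : T * U) s : iter 2 rest (code_pair t ++ s) = s.
Proof. by rewrite /code_pair -catA !iterS !rest_code_elt. Qed.

Lemma rest_code_triple (T U V : finType) (t : T * U * V) s : iter 3 rest (code_triple t ++ s) = s.
Proof. by rewrite /code_triple cat3A !iterS !rest_code_elt. Qed.

Lemma lists1_code (T : finType) (l : seq T) s (t : T) :
  lists1 (code_seq (@code_elt T) l ++ s) (enum_rank t) = (t \in l).
Proof.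
rewrite /lists1 -has_pred1; apply: has_items_code => [u s'|u s'] /=.
  exact: rest_code_elt.
by rewrite num_code_elt rank_eq.
Qed.

Lemma lists2_code (T U : finType) (l : seq (T * U)) s (t : T) (u : U) :
  lists2 (code_seq (@code_pair T U) l ++ s) (enum_rank t) (enum_rank u) = ((t, u) \in l).
Proof.
rewrite /lists2 -has_pred1; apply: has_items_code => [v s'|[t' u'] s'] /=.
  exact: rest_code_pair.
by rewrite /code_pair -catA rest_code_elt !num_code_elt !rank_eq.
Qed.

Lemma lists3_code (T U V : finType) (l : seq (T * U * V)) s (t : T) (u : U) (v : V) :
  lists3 (code_seq (@code_triple T U V) l ++ s) (enum_rank t) (enum_rank u) (enum_rank v) =
    ((t, u, v) \in l).
Proof.
rewrite /lists3 -has_pred1; apply: has_items_code => [w s'|[[t' u'] v'] s'].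
  exact: rest_code_triple.
by rewrite /code_triple cat3A !rest_code_elt !num_code_elt !rank_eq /= andbA.
Qed.

Lemma alln_rank (T : finType) (P : pred nat) : alln #|T| P = [forall t : T, P (enum_rank t)].
Proof.
apply/allP/forallP => [H t|H i]; first by apply: H; rewrite mem_iota /=.
rewrite mem_iota /= => lt_i; have := H (enum_val (Ordinal lt_i)).
by rewrite enum_valK.
Qed.

Lemma exn_rank (T : finType) (P : pred nat) : exn #|T| P = [exists t : T, P (enum_rank t)].
Proof.
apply/negb_inj; rewrite -all_predC negb_exists; exact: (alln_rank T (predC P)).
Qed.

Definition code_edge (Ag S Act : finType) (t : S * {ffun Ag -> Act} * S) :=
  code_elt t.1.1 ++ code_profile t.1.2 ++ code_elt t.2.

Lemma rest_code_edge (Ag S Act : finType) (t : S * {ffun Ag -> Act} * S) s :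
  iter #|Ag|.+2 rest (code_edge t ++ s) = s.
Proof.
by rewrite /code_edge cat3A iterS iterSr rest_code_elt rest_code_profile rest_code_elt.
Qed.

(** Stated for bare types and lists, so that it serves for decoding as well, where the structure is
    yet to be built. *)
Definition code_struct (Ag AP S Act : finType) (i0 : S) (lk : seq (Ag * S * S))
    (ac : seq (Ag * S * Act)) (ed : seq (S * {ffun Ag -> Act} * S)) (lb : seq (S * AP)) :=
  code_nat #|S| ++ code_nat #|Act| ++ code_elt i0 ++
  code_seq (@code_triple _ _ _) lk ++ code_seq (@code_triple _ _ _) ac ++
  code_seq (@code_edge _ _ _) ed ++ code_seq (@code_pair _ _) lb.

Section CodeStruct.
Variables (Ag AP S Act : finType) (i0 : S) (lk : seq (Ag * S * S)) (ac : seq (Ag * S * Act))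
  (ed : seq (S * {ffun Ag -> Act} * S)) (lb : seq (S * AP)) (s : seq bool).

Local Notation g := (code_struct i0 lk ac ed lb ++ s).

Lemma code_structE : g =
  code_nat #|S| ++ code_nat #|Act| ++ code_elt i0 ++
  code_seq (@code_triple _ _ _) lk ++ code_seq (@code_triple _ _ _) ac ++
  code_seq (@code_edge _ _ _) ed ++ code_seq (@code_pair _ _) lb ++ s.
Proof. by rewrite /code_struct -!catA. Qed.

Lemma states_code : states g = #|S|.
Proof. by rewrite code_structE /states num_code_nat. Qed.

Lemma actions_code : actions g = #|Act|.
Proof. by rewrite code_structE /actions rest_code_nat num_code_nat. Qed.

Lemma initial_code : initial g = enum_rank i0.
Proof. by rewrite code_structE /initial !rest_code_nat num_code_elt. Qed.

Lemma links_code : links g = code_seq (@code_triple _ _ _) lk ++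
  code_seq (@code_triple _ _ _) ac ++ code_seq (@code_edge _ _ _) ed ++
  code_seq (@code_pair _ _) lb ++ s.
Proof. by rewrite code_structE /links !rest_code_nat. Qed.

Lemma acts_code : acts g = code_seq (@code_triple _ _ _) ac ++
  code_seq (@code_edge _ _ _) ed ++ code_seq (@code_pair _ _) lb ++ s.
Proof. rewrite /acts links_code after_code //; exact: rest_code_triple. Qed.

Lemma edges_code : edges g = code_seq (@code_edge _ _ _) ed ++ code_seq (@code_pair _ _) lb ++ s.
Proof. rewrite /edges acts_code after_code //; exact: rest_code_triple. Qed.

Lemma labels_code : labels #|Ag| g = code_seq (@code_pair _ _) lb ++ s.
Proof. rewrite /labels edges_code after_code //; exact: rest_code_edge. Qed.

Lemma beyond_code : beyond #|Ag| g = s.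
Proof. rewrite /beyond labels_code after_code //; exact: rest_code_pair. Qed.
End CodeStruct.

(** * What a code reveals about its structure *)

Section Describes.
Variables (Ag AP : finType) (G : iCGS Ag AP).

(* [e] is a transition of [G] written at the front of [v]. *)
Record reads_edge (v : seq bool) (e : St G * {ffun Ag -> Act G} * St G) : Prop := ReadsEdge {
  read_source : num v = enum_rank e.1.1;
  read_profile : forall i, fld (rest v) (enum_rank i) = enum_rank (e.1.2 i);
  read_target : fld (rest v) #|Ag| = enum_rank e.2
}.

(** Order and repetitions of the lists disappear here. Transitions are accessible only through tests
    on items that depend on the transition read there, as an item is a suffix of the string. *)
Record describes (g : seq bool) : Prop := Describes {
  d_states : states g = #|St G|;
  d_actions : actions g = #|Act G|;
  d_links : forall (i : Ag) (s t : St G), lists3 (links g) (enum_rank i) (enum_rank s) (enum_rank t) = ind i s t;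
  d_acts : forall (i : Ag) (s : St G) (a : Act G),
    lists3 (acts g) (enum_rank i) (enum_rank s) (enum_rank a) = (a \in avail i s);
  d_labels : forall (s : St G) (p : AP), lists2 (labels #|Ag| g) (enum_rank s) (enum_rank p) = (p \in label s);
  d_edges : forall P (Q : pred (St G * {ffun Ag -> Act G} * St G)),
    (forall v e, reads_edge v e -> P v = Q e) ->
    has P (items #|Ag|.+2 (edges g)) = [exists e, trans e.1.1 e.1.2 e.2 && Q e]
}.

Lemma d_alledges g P (Q : pred (St G * {ffun Ag -> Act G} * St G)) : describes g ->
  (forall v e, reads_edge v e -> P v = Q e) ->
  all P (items #|Ag|.+2 (edges g)) = [forall e, trans e.1.1 e.1.2 e.2 ==> Q e].
Proof.
move=> dg PQ; apply: negb_inj; rewrite -has_predC (d_edges dg (Q := predC Q)).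
  by rewrite negb_forall; apply: eq_existsb => e; rewrite negb_imply.
by move=> v e /PQ /= ->.
Qed.

Lemma reads_code_edge e s : reads_edge (code_edge e ++ s) e.
Proof.
rewrite /code_edge cat3A; split=> [|i|]; first by rewrite num_code_elt.
  by rewrite rest_code_elt fld_code_profile.
by rewrite rest_code_elt /fld rest_code_profile num_code_elt.
Qed.

Lemma encodes_structP w : encodes_iCGS G w <->
  exists lk ac ed lb,
  [/\ forall (i : Ag) (s s' : St G), ((i, s, s') \in lk) = ind i s s',
      forall (i : Ag) (s : St G) (a : Act G), ((i, s, a) \in ac) = (a \in avail i s),
      forall (s : St G) a (s' : St G), ((s, a, s') \in ed) = trans s a s',
      forall (s : St G) (p : AP), ((s, p) \in lb) = (p \in label s)
    & w = code_struct (init G) lk ac ed lb].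
Proof. by []. Qed.

Lemma encodes_describes w s : encodes_iCGS G w -> describes (w ++ s).
Proof.
case/encodes_structP=> lk [ac [ed [lb [Hlk Hac Hed Hlb ->]]]]; split.
- exact: states_code.
- exact: actions_code.
- by move=> i t u; rewrite links_code lists3_code Hlk.
- by move=> i t a; rewrite acts_code lists3_code Hac.
- by move=> t p; rewrite labels_code lists2_code Hlb.
move=> P Q PQ; rewrite edges_code.
rewrite (has_items_code (@rest_code_edge _ _ _) (Q := Q)); last first.
  by move=> e s'; apply: PQ; apply: reads_code_edge.
apply/hasP/existsP => [[[[t a] u] He Qe]|[[[t a] u] /andP[He Qe]]]; exists (t, a, u) => //.
  by rewrite -Hed He.
by rewrite Hed.
Qed.

Lemma encodes_wf w s : encodes_iCGS G w -> wf_struct #|Ag| #|AP| (w ++ s).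
Proof.
move=> enc; have dg := encodes_describes s enc.
have [lk [ac [ed [lb [_ _ _ _ Ew]]]]] := (encodes_structP w).1 enc.
rewrite /wf_struct (d_states dg) (d_actions dg); do ![apply/andP; split].
- exact: Act_gt0.
- by rewrite Ew initial_code.
- rewrite Ew links_code (all_items_code (@rest_code_triple _ _ _) (Q := predT)) ?all_predT //.
  by move=> [[i t] u] s'; rewrite /code_triple cat3A !rest_code_elt !num_code_elt !ltn_ord.
- rewrite Ew acts_code (all_items_code (@rest_code_triple _ _ _) (Q := predT)) ?all_predT //.
  by move=> [[i t] u] s'; rewrite /code_triple cat3A !rest_code_elt !num_code_elt !ltn_ord.
- rewrite (d_alledges (Q := predT) dg); first by apply/forallP => e; apply/implyP.
  move=> v e [-> Hp ->]; rewrite !ltn_ord andbT /= alln_rank.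
  by apply/forallP => i; rewrite Hp.
- rewrite Ew labels_code (all_items_code (@rest_code_pair _ _) (Q := predT)) ?all_predT //.
  by move=> [t u] s'; rewrite /code_pair -catA !rest_code_elt !num_code_elt !ltn_ord.
- rewrite alln_rank; apply/forallP => i; rewrite alln_rank; apply/forallP => t.
  have [refl_i _] := ind_equiv i t t t; rewrite (d_links dg) refl_i /= alln_rank.
  apply/forallP => u; rewrite (d_links dg); apply/implyP => ind_tu.
  rewrite !alln_rank; apply/andP; split; apply/forallP => z; rewrite ?(d_links dg) ?(d_acts dg).
    by have [_ ->] := ind_equiv i t u z.
  by rewrite (avail_ind ind_tu).
- rewrite alln_rank; apply/forallP => i; rewrite alln_rank; apply/forallP => t.
  have /set0Pn[a Ha] := avail_neq0 i t; rewrite exn_rank; apply/existsP; exists a.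
  by rewrite (d_acts dg).
rewrite (d_alledges (Q := fun e => [forall i, e.1.2 i \in avail i e.1.1]) dg).
  apply/forallP => e; apply/implyP => He; apply/forallP.
  by apply/transP; exists e.2.
move=> v e [-> Hp _]; rewrite alln_rank; apply: eq_forallb => i.
by rewrite Hp (d_acts dg).
Qed.

(** An arbitrary string matters only through its first [#|Ag|] numbers; when these are in range they
    form a joint action, to which [transP] applies. *)
Lemma encodes_profile_ok w s u : encodes_iCGS G w -> profile_ok #|Ag| (w ++ s) u.
Proof.
move=> enc; have dg := encodes_describes s enc.
rewrite /profile_ok (d_states dg) (d_actions dg) alln_rank; apply/forallP => t.
rewrite alln_rank; apply/implyP => /forallP Hu.
have lt_u (i : Ag) : fld u (enum_rank i) < #|Act G| by have /andP[] := Hu i.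
pose a := [ffun i => enum_val (Ordinal (lt_u i))] : {ffun Ag -> Act G}.
have Ea (i : Ag) : fld u (enum_rank i) = enum_rank (a i) by rewrite ffunE enum_valK.
have [t' Ht'] : exists t', trans t a t'.
  by apply/transP => i; have /andP[_] := Hu i; rewrite Ea (d_acts dg).
rewrite (d_edges (Q := fun e => (e.1.1 == t) && [forall i, e.1.2 i == a i]) dg).
  by apply/existsP; exists (t, a, t'); rewrite Ht' eqxx /=; apply/forallP.
move=> v e [-> Hp _]; rewrite rank_eq alln_rank; congr (_ && _); apply: eq_forallb => i.
by rewrite Hp Ea rank_eq.
Qed.
End Describes.

Section Views.
Variables (Ag AP : finType) (G G' : iCGS Ag AP) (A : {set Ag}) (q : St G) (q' : St G').

Record views (x : seq bool) : Prop := Views {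
  v_agents : agents x = #|Ag|;
  v_atoms : atoms x = #|AP|;
  v_struct1 : exists w s, encodes_iCGS G w /\ struct1 x = w ++ s;
  v_struct2 : exists w s, encodes_iCGS G' w /\ struct2 x = w ++ s;
  v_members : forall i : Ag, lists1 (members x) (enum_rank i) = (i \in A);
  v_point1 : num (point1 x) = enum_rank q;
  v_point2 : num (point2 x) = enum_rank q';
  v_wf : wf_instance x
}.

Lemma beyond_encodes (H : iCGS Ag AP) w s : encodes_iCGS H w -> beyond #|Ag| (w ++ s) = s.
Proof. by case/encodes_structP=> lk [ac [ed [lb [_ _ _ _ ->]]]]; apply: beyond_code. Qed.

Lemma encodes_views x : encodes_instance A q q' x -> views x.
Proof.
case=> w [w' [mem [enc enc' memA Ex]]].
have Eag : agents x = #|Ag| by rewrite Ex /agents num_code_nat.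
have Eat : atoms x = #|AP| by rewrite Ex /atoms rest_code_nat num_code_nat.
have E1 : struct1 x = w ++ w' ++ code_seq (@code_elt Ag) mem ++ code_elt q ++ code_elt q'.
  by rewrite Ex /struct1 !rest_code_nat.
have E2 : struct2 x = w' ++ code_seq (@code_elt Ag) mem ++ code_elt q ++ code_elt q'.
  by rewrite /struct2 E1 Eag (beyond_encodes _ enc).
have Em : members x = code_seq (@code_elt Ag) mem ++ code_elt q ++ code_elt q'.
  by rewrite /members E2 Eag (beyond_encodes _ enc').
have Ep1 : point1 x = code_elt q ++ code_elt q'.
  by rewrite /point1 Em after_code // => t s; apply: rest_code_elt.
have Ep2 : point2 x = code_elt q' by rewrite /point2 Ep1 rest_code_elt.
have Eq : num (point1 x) = enum_rank q by rewrite Ep1 num_code_elt.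
have Eq' : num (point2 x) = enum_rank q'.
  by rewrite Ep2 -[code_elt q']cats0 num_code_elt.
split=> //; first by exists w; eexists; split; [exact: enc|exact: E1].
- by exists w'; eexists; split; [exact: enc'|exact: E2].
- by move=> i; rewrite Em lists1_code memA.
rewrite /wf_instance Eag Eat Eq Eq' E1 E2 (encodes_wf _ enc) (encodes_wf _ enc').
rewrite (d_states (encodes_describes _ enc)) (d_states (encodes_describes _ enc')) !ltn_ord.
have rest_elt (t : Ag) s : iter 1 rest (code_elt t ++ s) = s by apply: rest_code_elt.
rewrite (Ag_gt0 G) Em (all_items_code rest_elt (Q := predT)) ?all_predT ?andbT.
  by rewrite Ep2 /code_elt /code_nat; elim: (nat_of_ord _) => // n; rewrite iterSr.
by move=> t s; rewrite num_code_elt ltn_ord.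
Qed.
End Views.

(** * Recovering an instance from its code *)

(** A non-empty remainder shows that the block of ones was terminated. This is why decoding
    propagates non-emptiness backwards from the end of the code. *)
Lemma code_nat_num s : rest s != [::] -> s = code_nat (num s) ++ rest s.
Proof.
elim: s => [|[] s IH] // ; have -> : rest (true :: s) = rest s by rewrite /rest /num /= -iterS iterSr.
by move=> /IH{1}->.
Qed.

Lemma restn_nil m : iter m rest [::] = [::].
Proof. by elim: m => //= m ->. Qed.

Lemma after_inv T (code : T -> seq bool) m s :
  (forall v, v \in items m s -> iter m rest v != [::] -> exists t, v = code t ++ iter m rest v) ->
  after m s != [::] -> exists l, s = code_seq code l ++ after m s.
Proof.
have fix_nil i : iter i (skip m) [::] = [::] by elim: i => //= i ->.
have fix_false i v : iter i (skip m) (false :: v) = false :: v by elim: i => //= i ->.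
(* The fuel is separated from the string, since after the first item it exceeds the length of what
   remains. *)
rewrite /items /after; have := leqnn (size s); move: {2 3 4 5}(size s) => j.
elim: j s => [|j IH] [|b s] // le_s; rewrite ?fix_nil //.
case: b le_s => le_s; last by rewrite fix_false; exists [::].
rewrite iterSr /skip /= -/(skip m) => dec nz.
have [|l El] := IH (iter m rest s) (leq_trans (size_restn m s) le_s) _ nz.
  by move=> v v_in; apply: dec; rewrite inE v_in orbT.
have [||t Et] := dec s; first by rewrite inE eqxx.
  by apply: contraNneq nz => ->; rewrite fix_nil.
by exists (t :: l); rewrite code_seq_cons -El -Et.
Qed.

Lemma rank_ord n (i : 'I_n) : enum_rank i = i :> nat.
Proof. by rewrite enum_rank_ord. Qed.

Lemma code_elt_ord n (i : 'I_n) : code_elt i = code_nat i.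
Proof. by rewrite /code_elt rank_ord. Qed.

Lemma code_elt_inv n v : num v < n -> rest v != [::] -> exists t : 'I_n, v = code_elt t ++ rest v.
Proof. by move=> lt_v nz; exists (Ordinal lt_v); rewrite code_elt_ord -code_nat_num. Qed.

Lemma rest_nz s : rest s != [::] -> s != [::].
Proof. by apply: contraNneq => ->. Qed.

Lemma code_pair_inv n1 n2 v : num v < n1 -> num (rest v) < n2 -> iter 2 rest v != [::] ->
  exists t : 'I_n1 * 'I_n2, v = code_pair t ++ iter 2 rest v.
Proof.
move=> lt1 lt2 nz; have [t1 E1] := code_elt_inv lt1 (rest_nz nz).
have [t2 E2] := code_elt_inv lt2 nz.
by exists (t1, t2); rewrite /code_pair -catA -E2 -E1.
Qed.

Lemma code_triple_inv n1 n2 n3 v : num v < n1 -> num (rest v) < n2 ->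
  num (rest (rest v)) < n3 -> iter 3 rest v != [::] ->
  exists t : 'I_n1 * 'I_n2 * 'I_n3, v = code_triple t ++ iter 3 rest v.
Proof.
move=> lt1 lt2 lt3 nz; have [t1 E1] := code_elt_inv lt1 (rest_nz (rest_nz nz)).
have [t2 E2] := code_elt_inv lt2 (rest_nz nz); have [t3 E3] := code_elt_inv lt3 nz.
by exists (t1, t2, t3); rewrite /code_triple cat3A -E3 -E2 -E1.
Qed.

Lemma code_profile_inv k n v : (forall i, i < k -> fld v i < n) -> iter k rest v != [::] ->
  exists a : {ffun 'I_k -> 'I_n}, v = code_profile a ++ iter k rest v.
Proof.
move=> lt_v nz; exists [ffun i : 'I_k => Ordinal (lt_v i (ltn_ord i))].
have -> : code_profile [ffun i : 'I_k => Ordinal (lt_v i (ltn_ord i))] =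
    flatten [seq code_nat (fld v j) | j <- iota 0 k].
  rewrite /code_profile -val_enum_ord -map_comp; congr flatten; apply: eq_map => i.
  by rewrite /= code_elt_ord ffunE.
elim: k nz {lt_v} => // k IH nz.
have -> : iota 0 k.+1 = rcons (iota 0 k) k by rewrite -addn1 iotaD cats1.
rewrite map_rcons flatten_rcons -catA iterS -code_nat_num //.
exact/IH/rest_nz.
Qed.

Lemma code_edge_inv k n1 n2 v : num v < n1 -> (forall i, i < k -> fld (rest v) i < n2) ->
  fld (rest v) k < n1 -> iter k.+2 rest v != [::] ->
  exists t : 'I_n1 * {ffun 'I_k -> 'I_n2} * 'I_n1, v = code_edge t ++ iter k.+2 rest v.
Proof.
move=> lt1 lt2 lt3; rewrite iterS iterSr => nz.
have [t3 E3] := code_elt_inv lt3 nz; have nz2 := rest_nz nz.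
have [t2 E2] := code_profile_inv lt2 nz2.
have nz3 : rest v != [::] by apply: contraNneq nz2 => ->; rewrite restn_nil.
have [t1 E1] := code_elt_inv lt1 nz3.
by exists (t1, t2, t3); rewrite /code_edge cat3A -E3 -E2 -E1.
Qed.

(** One half of [transP] is the last clause of [wf_struct]; the other is [profile_ok] at the code of
    the given joint action. *)
Lemma build_iCGS (Ag AP S Act : finType) (i0 : S) lk ac ed lb s :
  0 < #|Ag| -> let g := @code_struct Ag AP S Act i0 lk ac ed lb ++ s in
  wf_struct #|Ag| #|AP| g ->
  (forall a : {ffun Ag -> Act}, profile_ok #|Ag| g (code_profile a)) ->
  exists2 G : iCGS Ag AP, St G = S & encodes_iCGS G (code_struct i0 lk ac ed lb).
Proof.
move=> Ag_gt0 g; rewrite /wf_struct states_code actions_code.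
case/andP=> Act_gt0 /andP[_ /andP[_ /andP[_ /andP[_ /andP[_ /andP[Hind /andP[Hav Hed]]]]]]] Hprof.
pose R i t u := (i, t, u) \in lk; pose D i t := [set a | (i, t, a) \in ac].
pose E t a u := (t, a, u) \in ed; pose L t := [set p | (t, p) \in lb].
have RE i t u : lists3 (links g) (enum_rank i) (enum_rank t) (enum_rank u) = R i t u.
  by rewrite links_code lists3_code.
have DE i t a : lists3 (acts g) (enum_rank i) (enum_rank t) (enum_rank a) = (a \in D i t).
  by rewrite acts_code lists3_code inE.
have R_equiv i : equivalence_rel (R i).
  have Ri t : R i t t && alln #|S| (fun u => lists3 (links g) (enum_rank i) (enum_rank t) u ==>
      alln #|S| (fun v => lists3 (links g) (enum_rank i) (enum_rank t) v ==
        lists3 (links g) (enum_rank i) u v)).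
    move: Hind; rewrite alln_rank => /forallP/(_ i); rewrite alln_rank => /forallP/(_ t).
    rewrite RE => /andP[-> /allP H] /=; apply/allP => u /H/implyP {}H; apply/implyP => /H.
    by case/andP.
  move=> t u v; split; first by have /andP[] := Ri v.
  have /andP[_] := Ri t; rewrite alln_rank => /forallP/(_ u); rewrite RE => /implyP H /H.
  by rewrite alln_rank => /forallP/(_ v)/eqP; rewrite !RE.
have D_neq0 i t : D i t != set0.
  move: Hav; rewrite alln_rank => /forallP/(_ i); rewrite alln_rank => /forallP/(_ t).
  by rewrite exn_rank => /existsP[a]; rewrite DE => Ha; apply/set0Pn; exists a.
have D_ind i t u : R i t u -> D i t = D i u.
  move=> Rtu; apply/setP => a; move: Hind; rewrite alln_rank => /forallP/(_ i).
  rewrite alln_rank => /forallP/(_ t)/andP[_]; rewrite alln_rank => /forallP/(_ u).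
  by rewrite RE Rtu /= alln_rank => /andP[_]; rewrite alln_rank => /forallP/(_ a)/eqP; rewrite !DE.
have E_dom t a : (exists u, E t a u) <-> forall i, a i \in D i t.
  split=> [[u Etu] i|Ha].
    move: Hed; rewrite edges_code (all_items_code (@rest_code_edge _ _ _)
        (Q := fun e => [forall i, e.1.2 i \in D i e.1.1])).
      by move/allP/(_ _ Etu)/forallP/(_ i).
    move=> [[t' a'] u'] s'; rewrite alln_rank; apply: eq_forallb => j.
    rewrite /code_edge cat3A rest_code_elt fld_code_profile num_code_elt /=.
    by rewrite -[RHS]DE.
  move: (Hprof a); rewrite /profile_ok states_code actions_code alln_rank => /forallP/(_ t).
  have -> : alln #|Ag| (fun i => (fld (code_profile a) i < #|Act|) &&
       lists3 (acts g) i (enum_rank t) (fld (code_profile a) i)).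
    rewrite alln_rank; apply/forallP => i; rewrite -[code_profile a]cats0 fld_code_profile.
    by rewrite ltn_ord DE Ha.
  rewrite /= edges_code (has_items_code (@rest_code_edge _ _ _)
      (Q := fun e => (e.1.1 == t) && [forall i, e.1.2 i == a i])).
    case/hasP=> [[[t' a'] u]] /= He /andP[/eqP Et /forallP Ea]; exists u.
    by rewrite -Et (_ : a = a') //; apply/ffunP => i; rewrite (eqP (Ea i)).
  move=> [[t' a'] u'] s'; rewrite alln_rank; rewrite /code_edge cat3A num_code_elt rank_eq.
  congr (_ && _); apply: eq_forallb => j.
  by rewrite -[code_profile a]cats0 rest_code_elt !fld_code_profile rank_eq.
exists (@Build_iCGS Ag AP S Act i0 R D E L Ag_gt0 Act_gt0 R_equiv D_neq0 D_ind E_dom) => //.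
by exists lk, ac, ed, lb; split=> // [i t a|t p]; rewrite /= inE.
Qed.

Lemma after_nz m s : after m s != [::] -> s != [::].
Proof. by apply: contraNneq => ->. Qed.

Lemma decode_struct k p g : wf_struct k p g -> beyond k g != [::] ->
  exists (i0 : 'I_(states g)) lk ac ed lb,
    g = @code_struct 'I_k 'I_p 'I_(states g) 'I_(actions g) i0 lk ac ed lb ++ beyond k g.
Proof.
case/and5P=> _ lt_i0 Hlk Hac /andP[Hed /andP[Hlb _]] nz_b.
have nz_lb := after_nz nz_b; have nz_ed := after_nz nz_lb.
have nz_ac := after_nz nz_ed; have nz_lk := after_nz nz_ac.
have [i0 Ei0] := code_elt_inv lt_i0 nz_lk.
have [lk Elk] : exists lk, links g = code_seq (@code_triple 'I_k 'I_(states g) 'I_(states g)) lk ++ acts g.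
  by apply: after_inv nz_ac => v /(allP Hlk)/and3P[? ? ?]; apply: code_triple_inv.
have [ac Eac] : exists ac, acts g = code_seq (@code_triple 'I_k 'I_(states g) 'I_(actions g)) ac ++ edges g.
  by apply: after_inv nz_ed => v /(allP Hac)/and3P[? ? ?]; apply: code_triple_inv.
have [ed Eed] : exists ed, edges g =
    code_seq (@code_edge 'I_k 'I_(states g) 'I_(actions g)) ed ++ labels k g.
  apply: after_inv nz_lb => v /(allP Hed)/and3P[? /allP Hp ?]; apply: code_edge_inv => // i lt_i.
  by apply: Hp; rewrite mem_iota.
have [lb Elb] : exists lb, labels k g = code_seq (@code_pair 'I_(states g) 'I_p) lb ++ beyond k g.
  by apply: after_inv nz_b => v /(allP Hlb)/andP[? ?]; apply: code_pair_inv.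
exists i0, lk, ac, ed, lb; rewrite code_structE -Elb -Eed -Eac -Elk -Ei0 !card_ord.
rewrite -code_nat_num ?(rest_nz nz_lk) // -code_nat_num //; exact/rest_nz/rest_nz.
Qed.

Definition profiles_ok b x := forall u, size u <= b ->
  profile_ok (agents x) (struct1 x) u && profile_ok (agents x) (struct2 x) u.

Lemma size_code_elt (T : finType) (t : T) : size (code_elt t) <= #|T|.
Proof. by rewrite size_cat size_nseq addn1. Qed.

Lemma size_code_profile (Ag T : finType) (a : {ffun Ag -> T}) :
  size (code_profile a) <= #|Ag| * #|T|.
Proof.
rewrite /code_profile cardE; elim: (enum Ag) => //= i l IH.
by rewrite size_cat mulSn leq_add ?size_code_elt.
Qed.

Lemma num_le_size s : num s <= size s.
Proof. exact: find_size. Qed.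

Lemma size_rest s : size (rest s) <= size s.
Proof. exact: (size_restn 1). Qed.

Lemma size_after m s : size (after m s) <= size s.
Proof.
rewrite /after size_behead; apply: leq_trans (leq_pred _) _.
elim: {1}(size s) => // j IH; apply: leq_trans IH; rewrite iterS /skip; case: ifP => // _.
by rewrite (leq_trans (size_restn _ _)) // size_behead leq_pred.
Qed.

Lemma size_beyond k g : size (beyond k g) <= size g.
Proof.
do 4! apply: leq_trans (size_after _ _) _.
by do 3! apply: leq_trans (size_rest _) _.
Qed.

(** As [G] is only asserted to exist, its states are reached through their codes; the last clause
    serves to decode the two points of an instance. *)
Lemma decode_iCGS k p g : 0 < k -> wf_struct k p g -> beyond k g != [::] ->
  (forall u, size u <= k * actions g -> profile_ok k g u) ->
  exists (G : iCGS 'I_k 'I_p) w, [/\ encodes_iCGS G w, g = w ++ beyond k g &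
    forall n, n < states g -> exists q : St G, code_elt q = code_nat n].
Proof.
move=> k_gt0 wf nz Hprof; have [i0 [lk [ac [ed [lb Eg]]]]] := decode_struct wf nz.
have [|||G SG enc] := build_iCGS (i0 := i0) (lk := lk) (ac := ac) (ed := ed) (lb := lb)
   (s := beyond k g).
- by rewrite card_ord.
- by rewrite -Eg !card_ord.
- move=> a; rewrite -Eg card_ord; apply: Hprof.
  by apply: leq_trans (size_code_profile a) _; rewrite !card_ord.
exists G, (code_struct i0 lk ac ed lb); split=> // n lt_n.
by rewrite SG; exists (Ordinal lt_n); rewrite code_elt_ord.
Qed.

Lemma code_nat_end s : iter (num s) behead s = [:: false] -> s = code_nat (num s).
Proof. by elim: s => [|[] s IH] //=; rewrite /num /= -iterS iterSr => /IH{1}->. Qed.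

Lemma decode_instance x : wf_instance x -> profiles_ok (size x * size x) x ->
  exists (Ag AP : finType) (G G' : iCGS Ag AP) (A : {set Ag}) (q : St G) (q' : St G'),
    encodes_instance A q q' x.
Proof.
case/and5P=> /eqP end_x Ag_gt0 wf1 wf2 /and3P[Hm lt_q lt_q'] Hprof.
have nz_p2 : point2 x != [::] by apply/negP => /eqP E; rewrite E in end_x.
have nz_p1 : point1 x != [::] by apply: rest_nz.
have nz_m := after_nz nz_p1; have nz_2 : struct2 x != [::].
  by apply: contraNneq nz_m => E; rewrite /members E.
have le1 : size (struct1 x) <= size x by do 2! apply: leq_trans (size_rest _) _.
have le2 : size (struct2 x) <= size x by apply: leq_trans (size_beyond _ _) le1.
(* A joint action is written as [agents x] numbers of at most [actions g] bits each; both counts are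
   in unary, hence at most the length of [x]. *)
have le_actions g : size g <= size x -> agents x * actions g <= size x * size x.
  move=> le_g; apply: leq_mul; first exact: num_le_size.
  by apply: leq_trans (num_le_size _) _; apply: leq_trans (size_rest _) le_g.
have [|G [w [enc Ew qs]]] := decode_iCGS Ag_gt0 wf1 nz_2.
  by move=> u le_u; have /andP[] := Hprof u (leq_trans le_u (le_actions _ le1)).
have [|G' [w' [enc' Ew' qs']]] := decode_iCGS Ag_gt0 wf2 nz_m.
  by move=> u le_u; have /andP[] := Hprof u (leq_trans le_u (le_actions _ le2)).
have [q Eq] := qs _ lt_q; have [q' Eq'] := qs' _ lt_q'.
have [mem Emem] : exists mem, members x = code_seq (@code_elt 'I_(agents x)) mem ++ point1 x.
  by apply: after_inv nz_p1 => v /(allP Hm); apply: code_elt_inv.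
exists 'I_(agents x), 'I_(atoms x), G, G', [set i in mem], q, q', w, w', mem; split=> //.
  by move=> i; rewrite inE.
rewrite Eq Eq' !card_ord -(code_nat_end end_x) -(code_nat_num nz_p2) -Emem -Ew' -Ew /agents /atoms /struct1.
rewrite -code_nat_num; last by apply: contraNneq nz_2 => E; rewrite /struct2 /struct1 E.
by rewrite -code_nat_num //; apply: contraNneq nz_2 => E; rewrite /struct2 /struct1 E.
Qed.

(** * Bisimilarity and the first-order condition *)

Lemma size_code_seq (T : Type) (code : T -> seq bool) M (l : seq T) :
  (forall t, size (code t) <= M) -> size (code_seq code l) <= size l * M.+1 + 1.
Proof.
move=> le_M; rewrite size_cat leq_add2r; elim: l => //= t l IH.
by rewrite size_cat mulSn addSn ltnS leq_add.
Qed.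

Definition code_set (T : finType) (P : pred T) (code : T -> seq bool) :=
  code_seq code [seq t <- enum T | P t].

Lemma size_code_set (T : finType) (P : pred T) code M : (forall t, size (code t) <= M) ->
  size (code_set P code) <= #|T| * M.+1 + 1.
Proof.
move=> le_M; apply: leq_trans (size_code_seq _ le_M) _.
by rewrite leq_add2r leq_mul2r size_filter cardE count_size orbT.
Qed.

Lemma mem_filter_enum (T : finType) (P : pred T) t : (t \in [seq t <- enum T | P t]) = P t.
Proof. by rewrite mem_filter mem_enum andbT. Qed.

(** * Neighbourhoods, strategies and simulations for a fixed coalition *)

Section Group.
Variables (Ag AP : finType) (A : {set Ag}) (m : seq bool).
Hypothesis m_A : forall i : Ag, lists1 m (enum_rank i) = (i \in A).

Section Neighbourhood.
Variables (G : iCGS Ag AP) (g n : seq bool).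
Hypothesis dg : describes G g.
Local Notation ev := (@everybody Ag AP G A).

Lemma group_linkE (s t : St G) :
  group_link #|Ag| m g (enum_rank s) (enum_rank t) = ev s t.
Proof.
rewrite /group_link exn_rank; apply: eq_existsb => i.
by rewrite m_A (d_links dg).
Qed.

Lemma ind_sym i (s t : St G) : ind i s t = ind i t s.
Proof.
have [_ H] := ind_equiv i s t s; have [_ H'] := ind_equiv i t s t.
have [refl_s _] := ind_equiv i s s s; have [refl_t _] := ind_equiv i t t t.
by apply/idP/idP => [/H|/H']; rewrite ?refl_s ?refl_t.
Qed.

Lemma connect_everybody_sym : connect_sym ev.
Proof.
apply: sym_connect_sym => s t /=; apply: eq_existsb => i; by rewrite ind_sym.
Qed.

Lemma neighbourhood_refl (s : St G) : s \in neighbourhood A s.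
Proof. by rewrite inE. Qed.

Lemma neighbourhood_eq (s t : St G) : (t \in neighbourhood A s) = (neighbourhood A s == neighbourhood A t).
Proof.
rewrite inE; apply/idP/eqP => [st|E]; last by have := neighbourhood_refl t; rewrite -E inE.
by apply/setP => u; rewrite !inE !(connect_everybody_sym u) (same_connect connect_everybody_sym st).
Qed.

Definition codes_neighbourhoods :=
  forall s t : St G, lists2 n (enum_rank s) (enum_rank t) = (t \in neighbourhood A s).

Lemma closed_linksP : closed_links #|Ag| m g n <->
  forall s : St G, lists2 n (enum_rank s) (enum_rank s) /\
    forall t u, lists2 n (enum_rank s) (enum_rank t) -> ev t u ->
      lists2 n (enum_rank s) (enum_rank u).
Proof.
rewrite /closed_links (d_states dg) alln_rank; split=> [/forallP H s|H].
  have /andP[Hs] := H s; rewrite alln_rank => /forallP H'; split=> // t u st.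
  have := H' t; rewrite st alln_rank => /forallP/(_ u); rewrite group_linkE => /implyP.
  exact.
apply/forallP => s; have [-> Hs] := H s; rewrite alln_rank; apply/forallP => t.
apply/implyP => st; rewrite alln_rank; apply/forallP => u; rewrite group_linkE.
by apply/implyP; apply: Hs.
Qed.

Lemma closed_uptoP z : closed_upto #|Ag| m g z n <->
  forall s : St G, lists1 z (enum_rank s) ->
   (forall t u : St G, lists1 z (enum_rank t) -> ev t u -> lists1 z (enum_rank u)) ->
   forall t : St G, lists2 n (enum_rank s) (enum_rank t) -> lists1 z (enum_rank t).
Proof.
have E : alln #|St G| (fun t => lists1 z t ==>
    alln #|St G| (fun u => group_link #|Ag| m g t u ==> lists1 z u)) <->
  forall t u : St G, lists1 z (enum_rank t) -> ev t u -> lists1 z (enum_rank u).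
  rewrite alln_rank; split=> [/forallP H t u zt|H].
    by have := H t; rewrite zt alln_rank => /forallP/(_ u); rewrite group_linkE => /implyP.
  apply/forallP => t; apply/implyP => zt; rewrite alln_rank; apply/forallP => u.
  by rewrite group_linkE; apply/implyP; apply: H.
rewrite /closed_upto (d_states dg) alln_rank; split=> [/forallP H s zs /E Hz t st|H].
  have := H s; rewrite zs Hz alln_rank => /forallP/(_ t); rewrite st; exact.
apply/forallP => s; apply/implyP => zs; apply/implyP => /E Hz; rewrite alln_rank.
by apply/forallP => t; apply/implyP; apply: H.
Qed.

Lemma neighbourhoods_complete : codes_neighbourhoods ->
  closed_links #|Ag| m g n /\ forall z, closed_upto #|Ag| m g z n.
Proof.
move=> Hn; split=> [|z].
  apply/closed_linksP => s; rewrite Hn neighbourhood_refl; split=> // t u.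
  rewrite !Hn !inE !(connect_everybody_sym _ s) => st tu.
  exact: connect_trans st (connect1 tu).
apply/closed_uptoP => s zs Hz t; rewrite Hn inE connect_everybody_sym => /connectP[p].
elim: p s zs => [|u p IH] s zs /=; first by move=> _ ->.
by move=> /andP[su pu]; apply: IH => //; apply: Hz su.
Qed.

(** Closure under links puts the whole neighbourhood into the list, by induction on paths. For the
    converse, the true neighbourhood of [s] is taken as [z]: it is closed, hence contains everything
    listed for [s]. The bound on [b] makes room for its code. *)
Lemma neighbourhoods_sound b : #|St G| * #|St G|.+1 + 1 <= b ->
  closed_links #|Ag| m g n -> (forall z, size z <= b -> closed_upto #|Ag| m g z n) ->
  codes_neighbourhoods.
Proof.
move=> le_b /closed_linksP Hl Hu s t; apply/idP/idP => [st|].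
  pose z := code_set (connect ev s) (@code_elt (St G)).
  have Ez u : lists1 z (enum_rank u) = connect ev s u.
    by rewrite -[z]cats0 lists1_code mem_filter_enum.
  have := closed_uptoP z; rewrite Hu; last first.
    by apply: leq_trans (size_code_set _ (@size_code_elt _)) le_b.
  case=> /(_ isT) H _; rewrite inE connect_everybody_sym -Ez; apply: (H s) st; rewrite ?Ez //.
  by move=> u v; rewrite !Ez => su uv; apply: connect_trans su (connect1 uv).
rewrite inE connect_everybody_sym => /connectP[p].
have [ss Hs] := Hl s; suff H s' : lists2 n (enum_rank s) (enum_rank s') ->
    path ev s' p -> lists2 n (enum_rank s) (enum_rank (last s' p)).
  by move=> sp ->; apply: H.
elim: p s' => //= u p IH s' ss' /andP[su pu]; apply: IH => //; exact: Hs su.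
Qed.
End Neighbourhood.

Section Strategy.
Variables (G : iCGS Ag AP) (g n : seq bool).
Hypotheses (dg : describes G g) (n_nbhd : codes_neighbourhoods G n).

(** Agreement is asked on [Q] only, since a string accepted by [strategy_ok] may list anything
    elsewhere. *)
Definition codes_strategy f (Q : {set St G}) (phi : coalition_pstrategy G A) :=
  forall (i : {i : Ag | i \in A}) (s : St G) (a : Act G), s \in Q ->
    lists3 f (enum_rank (val i)) (enum_rank s) (enum_rank a) = (phi i s == Some a).

Lemma strategy_okP (q : St G) f :
  strategy_ok #|Ag| m g n (enum_rank q) f <->
  forall (i : Ag) (s : St G), i \in A -> s \in neighbourhood A q ->
    (exists a : Act G, lists3 f (enum_rank i) (enum_rank s) (enum_rank a)) /\
    forall a : Act G, lists3 f (enum_rank i) (enum_rank s) (enum_rank a) ->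
      a \in avail i s /\
      forall (t : St G) (b : Act G), t \in neighbourhood A q -> ind i s t ->
        lists3 f (enum_rank i) (enum_rank t) (enum_rank b) -> a = b.
Proof.
rewrite /strategy_ok (d_states dg) (d_actions dg) alln_rank; split.
  move=> /forallP H i s iA sQ; have := H i; rewrite m_A iA alln_rank => /forallP/(_ s).
  rewrite n_nbhd sQ /= exn_rank => /andP[/existsP ex]; rewrite alln_rank => /forallP Ha.
  split=> // a fa; have := Ha a; rewrite fa (d_acts dg) /= => /andP[av].
  rewrite alln_rank => /forallP Ht; split=> // t b tQ st ftb.
  have := Ht t; rewrite n_nbhd tQ (d_links dg) st /= alln_rank => /forallP/(_ b).
  by rewrite ftb rank_eq => /eqP.
move=> H; apply/forallP => i; rewrite m_A; apply/implyP => iA; rewrite alln_rank.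
apply/forallP => s; rewrite n_nbhd; apply/implyP => sQ; have [ex Ha] := H i s iA sQ.
rewrite exn_rank; apply/andP; split; first exact/existsP.
rewrite alln_rank; apply/forallP => a; apply/implyP => fa; have [av Ht] := Ha a fa.
rewrite (d_acts dg) av alln_rank; apply/forallP => t; rewrite n_nbhd (d_links dg).
apply/implyP => /andP[tQ st]; rewrite alln_rank; apply/forallP => b; rewrite rank_eq.
by apply/implyP => fb; apply/eqP; apply: Ht tQ st fb.
Qed.

Lemma decode_strategy (q : St G) f : strategy_ok #|Ag| m g n (enum_rank q) f ->
  exists phi, PStr (neighbourhood A q) phi /\ codes_strategy f (neighbourhood A q) phi.
Proof.
move=> /strategy_okP H.
pose F (i : Ag) (s : St G) (a : Act G) := lists3 f (enum_rank i) (enum_rank s) (enum_rank a).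
(* Cutting down to the neighbourhood gives exactly the required domain; there the action picked is
   the only one listed. *)
pose phi : coalition_pstrategy G A := [ffun i => [ffun s =>
  if s \in neighbourhood A q then [pick a | F (val i) s a] else None]].
have phiE i s : s \in neighbourhood A q -> exists a, phi i s = Some a /\ F (val i) s a.
  move=> sQ; rewrite !ffunE sQ; case: pickP => [a Fa|no]; first by exists a.
  by have [[a]] := H _ s (valP i) sQ; rewrite -/(F _ _ _) no.
have cod : codes_strategy f (neighbourhood A q) phi.
  move=> i s a sQ; have [b [-> Fb]] := phiE i s sQ; have [_ Ha] := H _ s (valP i) sQ.
  have [refl_s _] := ind_equiv (val i) s s s.
  apply/idP/eqP => [Fa|[<-] //]; congr Some.
  by have [_ Hb] := Ha b Fb; apply: Hb sQ _ Fa.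
exists phi; split=> // i; split; last first.
  apply/setP => s; rewrite inE; case: (boolP (s \in _)) => sQ.
    by have [a [-> _]] := phiE i s sQ.
  by rewrite !ffunE (negPf sQ).
have domQ s a : phi i s = Some a -> s \in neighbourhood A q.
  by rewrite !ffunE; case: ifP.
split=> [s a E|s t]; last rewrite !inE.
  have sQ := domQ _ _ E; have [_ Ha] := H _ s (valP i) sQ.
  by have [] := Ha a; rewrite // cod // E.
case Es: (phi i s) => [a|//]; case Et: (phi i t) => [b|//] _ _ st; congr Some.
have [sQ tQ] := (domQ _ _ Es, domQ _ _ Et); have [_ Ha] := H _ s (valP i) sQ.
have [|_ Hb] := Ha a; first by rewrite cod // Es.
by apply: (Hb t b) => //; rewrite cod // Et.
Qed.

Lemma encoded_strategy_ok (q : St G) f phi : PStr (neighbourhood A q) phi ->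
  codes_strategy f (neighbourhood A q) phi -> strategy_ok #|Ag| m g n (enum_rank q) f.
Proof.
move=> Hphi cod; apply/strategy_okP => i s iA sQ.
pose i' : {i : Ag | i \in A} := Sub i iA; have Ei : i = val i' by [].
have [[av unif] domQ] := Hphi i'; rewrite Ei.
have Hdom t : t \in neighbourhood A q -> t \in dom (phi i') by rewrite domQ.
split.
  have := Hdom s sQ; rewrite inE; case E: (phi i' s) => [a|//] _.
  by exists a; rewrite cod // E.
move=> a; rewrite cod // => /eqP Ea; split; first exact: av Ea.
move=> t b tQ st; rewrite cod // => /eqP Eb.
by have := unif s t (Hdom s sQ) (Hdom t tQ) st; rewrite Ea Eb => -[].
Qed.

Definition strategy_code (phi : coalition_pstrategy G A) : seq bool :=
  code_set (fun e : Ag * St G * Act G =>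
    if insub e.1.1 is Some i then phi i e.1.2 == Some e.2 else false) (@code_triple _ _ _).

Lemma strategy_codeP phi Q : codes_strategy (strategy_code phi) Q phi.
Proof.
move=> i s a _; rewrite -[strategy_code phi]cats0 lists3_code mem_filter_enum /=.
by rewrite valK.
Qed.

Lemma size_strategy_code phi : size (strategy_code phi) <=
  #|Ag| * #|St G| * #|Act G| * (#|Ag| + #|St G| + #|Act G|).+1 + 1.
Proof.
rewrite -!card_prod; apply: size_code_set => t; rewrite /code_triple.
rewrite (size_cat (code_elt _)) (size_cat (code_elt _)).
apply: leq_trans (leq_add (size_code_elt _) (leq_add (size_code_elt _) (size_code_elt _))) _.
by rewrite addnA.
Qed.

Lemma follows_edge f Q phi v (e : St G * {ffun Ag -> Act G} * St G) :
  codes_strategy f Q phi -> reads_edge v e -> e.1.1 \in Q ->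
  follows #|Ag| m f v = [forall i, phi i e.1.1 == Some (e.1.2 (val i))].
Proof.
move=> cod [Es Ea _] eQ; rewrite /follows alln_rank; apply/forallP/forallP => H i.
  by rewrite -cod // -Es -Ea; have := H (val i); rewrite m_A (valP i).
rewrite m_A; apply/implyP => iA; rewrite Es Ea.
have := H (Sub i iA); by rewrite -cod.
Qed.

End Strategy.

Section Simulation.
Variables (G G' : iCGS Ag AP) (g g' r n n' : seq bool).
Hypotheses (dg : describes G g) (dg' : describes G' g').
Hypotheses (n_nbhd : codes_neighbourhoods G n) (n_nbhd' : codes_neighbourhoods G' n').

Local Notation R := (fun (s : St G) (s' : St G') => lists2 r (enum_rank s) (enum_rank s')).

(** Condition (c) for one strategy and one response. No distinguished pair of states occurs in it,
    so a response found at one related pair serves all pairs with the same neighbourhoods. *)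
Definition matches (Q : {set St G}) (Q' : {set St G'}) phi phi' :=
  forall s s', s \in Q -> s' \in Q' -> R s s' -> forall t', t' \in succ (A := A) s' phi' ->
    exists t, t \in succ (A := A) s phi /\ R t t'.

Lemma matchesP (q : St G) (q' : St G') f w phi phi' :
  codes_strategy f (neighbourhood A q) phi -> codes_strategy w (neighbourhood A q') phi' ->
  alln (states g) (fun s => alln (states g') (fun s' =>
    [&& lists2 n (enum_rank q) s, lists2 n' (enum_rank q') s' & lists2 r s s'] ==>
    all (fun v' => (num v' == s') && follows #|Ag| m w v' ==>
      has (fun v => [&& num v == s, follows #|Ag| m f v &
          lists2 r (fld (rest v) #|Ag|) (fld (rest v') #|Ag|)])
        (items #|Ag|.+2 (edges g))) (items #|Ag|.+2 (edges g')))) <->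
  matches (neighbourhood A q) (neighbourhood A q') phi phi'.
Proof.
move=> cod cod'.
have E (s : St G) (s' : St G') : s \in neighbourhood A q -> s' \in neighbourhood A q' ->
  all (fun v' => (num v' == enum_rank s') && follows #|Ag| m w v' ==>
      has (fun v => [&& num v == enum_rank s, follows #|Ag| m f v &
          lists2 r (fld (rest v) #|Ag|) (fld (rest v') #|Ag|)])
        (items #|Ag|.+2 (edges g))) (items #|Ag|.+2 (edges g')) =
  [forall t', (t' \in succ s' phi') ==> [exists t, (t \in succ s phi) && R t t']].
  move=> sQ sQ'.
  rewrite (d_alledges dg' (Q := fun e => (e.1.1 == s') &&
      [forall i, phi' i e.1.1 == Some (e.1.2 (val i))] ==> [exists t, (t \in succ s phi) && R t e.2])).
    apply/forallP/forallP => [H t'|H [[u a] t'] /=].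
      apply/implyP; rewrite inE => /existsP[a /andP[tr Ha]].
      by have := H (s', a, t'); rewrite /= tr eqxx Ha.
    apply/implyP => tr; apply/implyP => /andP[/eqP Eu Ha].
    have := H t'; rewrite inE => /implyP; apply.
    by apply/existsP; exists a; rewrite -Eu tr Ha.
  move=> v' e' Hv'; rewrite (read_source Hv') rank_eq (read_target Hv').
  case: eqP => // Es'; rewrite (follows_edge cod' Hv') ?Es' // ; congr (_ ==> _).
  rewrite (d_edges dg (Q := fun e => [&& e.1.1 == s,
      [forall i, phi i e.1.1 == Some (e.1.2 (val i))] & R e.2 e'.2])).
    apply/existsP/existsP => [[[[u a] t] /= /andP[tr /and3P[/eqP Eu Ha Rt]]]|[t]].
      exists t; rewrite Rt andbT inE; apply/existsP; exists a.
      by rewrite -Eu tr Ha.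
    rewrite inE => /andP[/existsP[a /andP[tr Ha]] Rt]; exists (s, a, t).
    by rewrite /= tr eqxx Ha.
  move=> v e Hv; rewrite (read_source Hv) rank_eq (read_target Hv).
  by case: eqP => // Es; rewrite (follows_edge cod Hv) ?Es.
rewrite (d_states dg) (d_states dg') alln_rank; split=> [/forallP H s s' sQ sQ' Rs t' Ht'|H].
  have := H s; rewrite alln_rank => /forallP/(_ s'); rewrite n_nbhd n_nbhd' sQ sQ' Rs /=.
  by rewrite E // => /forallP/(_ t'); rewrite Ht' => /existsP[t /andP[? ?]]; exists t.
apply/forallP => s; rewrite alln_rank; apply/forallP => s'; rewrite n_nbhd n_nbhd'.
apply/implyP => /and3P[sQ sQ' Rs]; rewrite E //; apply/forallP => t'; apply/implyP => Ht'.
by have [t [? ?]] := H s s' sQ sQ' Rs t' Ht'; apply/existsP; exists t; apply/andP.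
Qed.

Lemma static_okP : static_ok #|Ag| #|AP| m g g' r n <->
  forall (q : St G) (q' : St G'), R q q' ->
  [/\ label q = label q',
      forall i s', i \in A -> ind i q' s' -> exists s, ind i q s /\ R s s'
    & forall q2, R q2 q' -> q2 \in neighbourhood A q].
Proof.
rewrite /static_ok (d_states dg) (d_states dg') alln_rank; split=> [/forallP H q q' Rq|H].
  have := H q; rewrite alln_rank => /forallP/(_ q'); rewrite Rq /= !alln_rank.
  case/and3P=> /forallP Hl /forallP Hi /forallP Hn; split=> [|i s' iA is'|q2 Rq2].
  - by apply/setP => p; have /eqP := Hl p; rewrite (d_labels dg) (d_labels dg').
  - have := Hi i; rewrite m_A iA alln_rank => /forallP/(_ s').
    rewrite (d_links dg') is' exn_rank => /existsP[s]; rewrite (d_links dg) => /andP[? ?].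
    by exists s.
  by have := Hn q2; rewrite Rq2 n_nbhd.
apply/forallP => q; rewrite alln_rank; apply/forallP => q'; apply/implyP => Rq.
have [El Hi Hn] := H q q' Rq; rewrite !alln_rank; apply/and3P; split; apply/forallP.
- by move=> p; rewrite (d_labels dg) (d_labels dg') El.
- move=> i; rewrite m_A; apply/implyP => iA; rewrite alln_rank; apply/forallP => s'.
  rewrite (d_links dg') exn_rank; apply/implyP => /(Hi i s' iA)[s [ind_s Rs]].
  by apply/existsP; exists s; rewrite (d_links dg) ind_s.
by move=> q2; rewrite n_nbhd; apply/implyP; apply: Hn.
Qed.

Definition strategy_size (H : iCGS Ag AP) :=
  #|Ag| * #|St H| * #|Act H| * (#|Ag| + #|St H| + #|Act H|).+1 + 1.

(** The response is the code of the value of the simulator. [S] agrees with the list pointwise only,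
    so that a converse relation fits as well. *)
Lemma simulation_complete (S : St G -> St G' -> bool) : (forall s s', R s s' = S s s') ->
  simulation A S ->
  static_ok #|Ag| #|AP| m g g' r n /\
  forall (q q' : nat) f, exists2 w, size w <= strategy_size G' &
    dynamic_ok #|Ag| m g g' r n n' q q' f w.
Proof.
move=> RS [[ST [simST HST]] Hfun]; split.
  apply/static_okP => q q'; rewrite RS => Sq; have [El Hi _] := HST q q' Sq; split=> //.
    by move=> i s' iA /(Hi i s' iA)[s [? ?]]; exists s; rewrite RS.
  by move=> q2; rewrite RS neighbourhood_eq => Sq2; rewrite (Hfun q q2 q' Sq Sq2).
move=> q q' f; rewrite /dynamic_ok (d_states dg) (d_states dg').
(* Challenges that fail the premise are answered by the empty string. *)
case: (ltnP q #|St G|) => [lt_q|_]; last by exists [::].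
case: (ltnP q' #|St G'|) => [lt_q'|_]; last by exists [::].
have -> : q = enum_rank (enum_val (Ordinal lt_q)) by rewrite enum_valK.
have -> : q' = enum_rank (enum_val (Ordinal lt_q')) by rewrite enum_valK.
move: (enum_val (Ordinal lt_q)) (enum_val (Ordinal lt_q')) => {lt_q lt_q' q q'} q q'.
rewrite RS; case: (boolP (S q q')) => [Sq|_]; last by exists [::].
case: (boolP (strategy_ok _ _ _ _ _ _)) => [ok|_]; last by exists [::].
have [phi [Hphi cod]] := decode_strategy dg n_nbhd ok.
have Hphi' := simST q q' Sq phi Hphi; have [_ _ Hst] := HST q q' Sq.
set phi' := ST _ _ _ in Hphi' Hst.
have cod' := @strategy_codeP _ phi' (neighbourhood A q').
exists (strategy_code phi') => [|/=]; first exact: size_strategy_code.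
rewrite (encoded_strategy_ok dg' n_nbhd' Hphi' cod') /=.
have := matchesP cod cod'; rewrite (d_states dg) (d_states dg') => M; apply/M.
move=> s s' sQ sQ'; rewrite RS => Ss t' Ht'.
have [t [? ?]] := Hst s s' sQ sQ' Ss phi Hphi t' Ht'.
by exists t; rewrite RS.
Qed.

(** A response is constrained only through the two neighbourhoods and the strategy, and such triples
    form a finite type. Finite choice over triples gives a simulator that depends on the pair of
    neighbourhoods alone. *)
Lemma simulation_sound : static_ok #|Ag| #|AP| m g g' r n ->
  (forall (q : St G) (q' : St G') f, size f <= strategy_size G ->
    exists w, dynamic_ok #|Ag| m g g' r n n' (enum_rank q) (enum_rank q') f w) ->
  simulation A R.
Proof.
move=> /static_okP Hst Hdyn; split; last first.
  move=> q1 q2 q' R1 R2; apply/eqP; rewrite -neighbourhood_eq.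
  by have [_ _] := Hst q1 q' R1; apply.
have [ST HST] : exists ST : {set St G} * {set St G'} * coalition_pstrategy G A ->
    coalition_pstrategy G' A, forall x,
  (exists q q', [/\ R q q', x.1.1 = neighbourhood A q, x.1.2 = neighbourhood A q' & PStr x.1.1 x.2]) ->
  PStr x.1.2 (ST x) /\ matches x.1.1 x.1.2 x.2 (ST x).
  apply: (fin_all_exists (P := fun x (phi' : coalition_pstrategy G' A) => (exists q q', [/\ R q q', x.1.1 = neighbourhood A q,
    x.1.2 = neighbourhood A q' & PStr x.1.1 x.2]) -> PStr x.1.2 phi' /\ matches x.1.1 x.1.2 x.2 phi')).
  move=> [[Q Q'] phi] /=.
  (* A triple that does not arise from related states receives the nowhere defined strategies as a
     default. *)
  have [[q [q' [Rq -> -> Hphi]]]|no] := classic (exists q q', [/\ R q q', Q = neighbourhood A q,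
    Q' = neighbourhood A q' & PStr Q phi]); last by exists [ffun=> [ffun=> None]].
  have cod := @strategy_codeP _ phi (neighbourhood A q).
  have [|w] := Hdyn q q' (strategy_code phi); first exact: size_strategy_code.
  rewrite /dynamic_ok (d_states dg) (d_states dg') !ltn_ord Rq.
  rewrite (encoded_strategy_ok dg n_nbhd Hphi cod) => /andP[ok Hm].
  have [phi' [Hphi' cod']] := decode_strategy dg' n_nbhd' ok.
  exists phi' => _; split=> //; apply/(matchesP cod cod').
  by rewrite (d_states dg) (d_states dg').
exists (fun Q Q' phi => ST (Q, Q', phi)); split=> [q q' Rq phi Hphi|q q' Rq].
  by have [] := HST (neighbourhood A q, neighbourhood A q', phi); first by exists q, q'.
have [El Hi _] := Hst q q' Rq; split=> // s s' sQ sQ' Rs phi Hphi t' Ht'.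
have [|_ M] := HST (neighbourhood A q, neighbourhood A q', phi); first by exists q, q'.
by have [t ?] := M s s' sQ sQ' Rs t' Ht'; exists t.
Qed.
End Simulation.
End Group.

(** A strategy lists at most [N ^ 3] triples of at most [3 * N] bits each, whence the degree 4; the
    factor 20 leaves room for markers, the relations in [u1] and the states in [u2]. *)
Definition certificate_bound N := 20 * N.+1 ^ 4.

Lemma certificate_bound_ge N :
  20 * (N * N * N * N + N * N * N + N * N + N + 1) <= certificate_bound N.
Proof. rewrite /certificate_bound !expnS expn0; lia. Qed.

(** * Correctness of the condition on codes of instances *)

Section Correctness.
Variables (Ag AP : finType) (G G' : iCGS Ag AP) (A : {set Ag}) (q : St G) (q' : St G').
Variable x : seq bool.
Hypothesis vx : views A q q' x.

Local Notation g := (struct1 x).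
Local Notation g' := (struct2 x).
Local Notation m := (members x).

Lemma describes1 : describes G g.
Proof. by have [w [s [enc ->]]] := v_struct1 vx; apply: encodes_describes. Qed.

Lemma describes2 : describes G' g'.
Proof. by have [w [s [enc ->]]] := v_struct2 vx; apply: encodes_describes. Qed.

Lemma profile_ok1 u : profile_ok #|Ag| g u.
Proof. by have [w [s [enc ->]]] := v_struct1 vx; apply: encodes_profile_ok enc. Qed.

Lemma profile_ok2 u : profile_ok #|Ag| g' u.
Proof. by have [w [s [enc ->]]] := v_struct2 vx; apply: encodes_profile_ok enc. Qed.

Lemma size_struct1 : size g <= size x.
Proof. by do 2! apply: leq_trans (size_rest _) _. Qed.

Lemma size_struct2 : size g' <= size x.
Proof. exact: leq_trans (size_beyond _ _) size_struct1. Qed.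

Lemma card_Ag_le : #|Ag| <= size x.
Proof. by rewrite -(v_agents vx); apply: num_le_size. Qed.

Lemma card_St1_le : #|St G| <= size x.
Proof. rewrite -(d_states describes1); exact: leq_trans (num_le_size _) size_struct1. Qed.

Lemma card_St2_le : #|St G'| <= size x.
Proof. rewrite -(d_states describes2); exact: leq_trans (num_le_size _) size_struct2. Qed.

Lemma card_Act1_le : #|Act G| <= size x.
Proof.
rewrite -(d_actions describes1); apply: leq_trans (num_le_size _) _.
exact: leq_trans (size_rest _) size_struct1.
Qed.

Lemma card_Act2_le : #|Act G'| <= size x.
Proof.
rewrite -(d_actions describes2); apply: leq_trans (num_le_size _) _.
exact: leq_trans (size_rest _) size_struct2.
Qed.

(** The two additional lengths pay for the states written in front of the strategy in a
    challenge. *)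
Lemma strategy_size_le (H : iCGS Ag AP) : #|St H| <= size x -> #|Act H| <= size x ->
  strategy_size H + (size x + size x) <= certificate_bound (size x).
Proof.
move=> le_S le_T; apply: leq_trans (certificate_bound_ge _).
apply: (@leq_trans (size x * size x * size x * (size x + size x + size x).+1 + 1 + (size x + size x))).
  by rewrite leq_add2r /strategy_size leq_add2r !leq_mul // ?ltnS ?leq_add // card_Ag_le.
move: (size x) => N; lia.
Qed.

Lemma bisimilar_complete : bisimilar A q q' ->
  exists2 u1, size u1 <= certificate_bound (size x) & forall u2,
  exists2 u3, size u3 <= certificate_bound (size x) &
  exists2 u5, size u5 <= certificate_bound (size x) & verifier x u1 u2 u3 u5.
Proof.
case=> R [[simR simR'] Rq].
pose cr := code_set (fun t => R t.1 t.2) (@code_pair (St G) (St G')).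
pose cr' := code_set (fun t => R t.2 t.1) (@code_pair (St G') (St G)).
pose cn := code_set (fun t => t.2 \in neighbourhood A t.1) (@code_pair (St G) (St G)).
pose cn' := code_set (fun t => t.2 \in neighbourhood A t.1) (@code_pair (St G') (St G')).
(* Each name denotes the suffix that starts with its list: lookups stop at the terminator of the
   list, and [after 2] leads to the next one. *)
pose n' := cn'; pose n := cn ++ n'; pose r' := cr' ++ n; pose r := cr ++ r'.
have Er' : after 2 r = r' by apply: after_code; apply: rest_code_pair.
have En : after 2 r' = n by apply: after_code; apply: rest_code_pair.
have En' : after 2 n = n' by apply: after_code; apply: rest_code_pair.
have Hr (s : St G) (s' : St G') : lists2 r (enum_rank s) (enum_rank s') = R s s'.
  by rewrite lists2_code mem_filter_enum.
have Hr' (s' : St G') (s : St G) : lists2 r' (enum_rank s') (enum_rank s) = R s s'.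
  by rewrite lists2_code mem_filter_enum.
have Hn : codes_neighbourhoods A G n by move=> s t; rewrite lists2_code mem_filter_enum.
have Hn' : codes_neighbourhoods A G' n'.
  by move=> s t; rewrite /n' -[cn']cats0 lists2_code mem_filter_enum.
have mA := v_members vx.
have [cl Hu] := neighbourhoods_complete mA describes1 Hn.
have [cl' Hu'] := neighbourhoods_complete mA describes2 Hn'.
have [st Hdyn] := simulation_complete mA describes1 describes2 Hn Hn' Hr simR.
have [st' Hdyn'] := simulation_complete mA describes2 describes1 Hn' Hn Hr' simR'.
have [[cA cS] cS'] := (card_Ag_le, card_St1_le, card_St2_le).
have [cT cT'] := (card_Act1_le, card_Act2_le).
exists r.
  apply: leq_trans (certificate_bound_ge _).
  have le_pair (T U : finType) (P : pred (T * U)) : #|T| <= size x -> #|U| <= size x ->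
      size (code_set P (@code_pair T U)) <= size x * size x * (size x + size x).+1 + 1.
    move=> le_T le_U; apply: leq_trans (size_code_set (M := size x + size x) _ _) _.
      move=> t; rewrite /code_pair (size_cat (code_elt _)).
      by apply: leq_add; apply: leq_trans (size_code_elt _) _.
    by rewrite leq_add2r card_prod !leq_mul.
  rewrite /r size_cat /r' size_cat /n size_cat /n'.
  apply: leq_trans (leq_add (le_pair _ _ _ cS cS') (leq_add (le_pair _ _ _ cS' cS)
    (leq_add (le_pair _ _ _ cS cS) (le_pair _ _ _ cS' cS')))) _.
  move: (size x) => N; lia.
move=> u2; have [u3 le_u3 ok3] := Hdyn (num u2) (num (rest u2)) (rest (rest u2)).
have [u5 le_u5 ok5] := Hdyn' (num (rest u2)) (num u2) (rest (rest u2)).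
exists u3; first exact: leq_trans le_u3 (leq_trans (leq_addr _ _) (strategy_size_le cS' cT')).
exists u5; first exact: leq_trans le_u5 (leq_trans (leq_addr _ _) (strategy_size_le cS cT)).
rewrite /verifier (v_wf vx) andTb Er' En En' (v_agents vx) (v_atoms vx) (v_point1 vx) (v_point2 vx).
apply/and5P; split; [exact: cl|exact: cl'| |exact: st|].
  rewrite (d_states describes1) (d_states describes2) alln_rank; apply/forallP => s.
  by rewrite alln_rank; apply/forallP => s'; rewrite Hr Hr'.
apply/and5P; split; [exact: st'|by rewrite Hr|exact: profile_ok1|exact: profile_ok2|].
by apply/and4P; split; [exact: Hu|exact: Hu'|exact: ok3|exact: ok5].
Qed.

Lemma bisimilar_sound u1 :
  (forall u2, size u2 <= certificate_bound (size x) -> exists u3 u5, verifier x u1 u2 u3 u5) ->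
  bisimilar A q q'.
Proof.
move=> Hv; set r := u1; set r' := after 2 r; set n := after 2 r'; set n' := after 2 n.
have {}Hv u2 : size u2 <= certificate_bound (size x) -> exists u3 u5,
    verifier_aux #|Ag| #|AP| m g g' r r' n n' (enum_rank q) (enum_rank q') u2 u3 u5.
  move=> /Hv[u3 [u5 /andP[_ ok]]]; exists u3, u5; move: ok.
  by rewrite (v_agents vx) (v_atoms vx) (v_point1 vx) (v_point2 vx).
have mA := v_members vx.
have [[cA cS] cS'] := (card_Ag_le, card_St1_le, card_St2_le).
have [cT cT'] := (card_Act1_le, card_Act2_le).
(* These clauses do not mention the challenge, so the empty one yields them. *)
have [u3 [u5 /and5P[cl cl' conv st /and3P[st' Rq _]]]] := Hv [::] isT.
have le_nbhd N M : N <= M -> N * N.+1 + 1 <= certificate_bound M.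
  move=> le_NM; apply: leq_trans (certificate_bound_ge _).
  apply: (@leq_trans (M * M.+1 + 1)); first by rewrite leq_add2r leq_mul.
  lia.
have Hn : codes_neighbourhoods A G n.
  apply: (neighbourhoods_sound mA describes1 (le_nbhd _ _ cS) cl) => z le_z.
  by have [? [? /and5P[_ _ _ _ /and5P[_ _ _ _ /and4P[]]]]] := Hv z le_z.
have Hn' : codes_neighbourhoods A G' n'.
  apply: (neighbourhoods_sound mA describes2 (le_nbhd _ _ cS') cl') => z le_z.
  by have [? [? /and5P[_ _ _ _ /and5P[_ _ _ _ /and4P[]]]]] := Hv z le_z.
have Hdyn (s : St G) (s' : St G') f : size f + (size x + size x) <= certificate_bound (size x) ->
    exists w w', dynamic_ok #|Ag| m g g' r n n' (enum_rank s) (enum_rank s') f w /\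
      dynamic_ok #|Ag| m g' g r' n' n (enum_rank s') (enum_rank s) f w'.
  (* The challenge in its third reading: two states, then a strategy. *)
  move=> le_f; have [|w [w']] := Hv (code_elt s ++ code_elt s' ++ f).
    apply: leq_trans le_f; rewrite size_cat size_cat addnA addnC leq_add2l.
    by apply: leq_add; apply: leq_trans (size_code_elt _) _.
  rewrite /verifier_aux !num_code_elt !rest_code_elt num_code_elt => H; exists w, w'.
  by case/and5P: H => _ _ _ _ /and5P[_ _ _ _ /and4P[]].
exists (fun s s' => lists2 r (enum_rank s) (enum_rank s')); split=> //; split.
  apply: (simulation_sound mA describes1 describes2 Hn Hn' st) => s s' f le_f.
  have [|w [w' []]] := Hdyn s s' f; last by exists w.
  by apply: leq_trans (strategy_size_le cS cT); rewrite leq_add2r.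
(* The second direction was checked on the listed converse, which [conv] identifies with the true
   one. *)
have -> : (fun (s' : St G') (s : St G) => lists2 r (enum_rank s) (enum_rank s')) =
    (fun s' s => lists2 r' (enum_rank s') (enum_rank s)).
  apply: functional_extensionality => s'; apply: functional_extensionality => s.
  move: conv; rewrite (d_states describes1) (d_states describes2) alln_rank => /forallP/(_ s).
  by rewrite alln_rank => /forallP/(_ s')/eqP.
apply: (simulation_sound mA describes2 describes1 Hn' Hn st') => s' s f le_f.
have [|w [w' []]] := Hdyn s s' f; last by exists w'.
by apply: leq_trans (strategy_size_le cS' cT'); rewrite leq_add2r.
Qed.
End Correctness.

Theorem theorem10 : SigmaP 5 bisimilarity_problem.
Proof.
pose V xs := verifier (nth [::] xs 0) (nth [::] xs 1) (nth [::] xs 2) (nth [::] xs 3) (nth [::] xs 5).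
exists V, (20%N%:P * ('X + 1%N%:P) ^+ 4)%R; split; first exact: polytime_verifier.
move=> x; have -> : ((20%N%:P * ('X + 1%N%:P) ^+ 4).[size x])%R = certificate_bound (size x).
  by rewrite hornerM horner_exp hornerD hornerX !hornerC -[LHS]/(20 * (size x + 1) ^ 4) addn1.
set b := certificate_bound _; split=> [[Ag [AP [G [G' [A [q [q' [enc bis]]]]]]]]|].
  have [u1 le_u1 H] := bisimilar_complete (encodes_views enc) bis.
  exists u1; split=> // u2 _; have [u3 le_u3 [u5 le_u5 ok]] := H u2.
  by exists u3; split=> // u4 _; exists u5.
case=> u1 [_ H].
have {}H u2 : size u2 <= b -> exists u3 u5, verifier x u1 u2 u3 u5.
  move=> /H[u3 [_ /(_ [::] isT)[u5 [_ ok]]]]; by exists u3, u5.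
(* Nothing is known about [x] yet: the well-formedness checks first produce an instance that it
   encodes, and only then does the condition speak of bisimilarity. *)
have wf : wf_instance x by have [? [? /andP[]]] := H [::] isT.
have prof : profiles_ok (size x * size x) x.
  move=> u le_u; have [|u3 [u5 /andP[_ ok]]] := H u.
    apply: leq_trans le_u (leq_trans _ (certificate_bound_ge _)); lia.
  by case/and5P: ok => _ _ _ _ /and5P[_ _ -> ->].
have [Ag [AP [G [G' [A [q [q' enc]]]]]]] := decode_instance wf prof.
exists Ag, AP, G, G', A, q, q'; split=> //.
exact: bisimilar_sound (encodes_views enc) _ H.
Qed.
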